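(* Let $\mathbb T=\{z\in\mathbb C:|z|=1\}$, and let $a_1,a_2\in\mathbb C$ be distinct points such that $a_1,a_2\notin\mathbb T$ and $a_1,a_2$ are not inverse points with respect to $\mathbb T$ (that is, $\overline{a_1}a_2\ne 1$). Then there exists a unique central conic $\mathcal D$ with foci $a_1$ and $a_2$ such that $(\mathbb T,\mathcal D)$ is a $4$-Poncelet pair. Moreover: (a) If $|a_1|<1$ and $|a_2|<1$, then $\mathcal D$ is an ellipse. (b) If $|a_1|>1$ and $|a_2|>1$, then $\mathcal D$ is an ellipse if $\operatorname{Re}(1-\overline{a_1}a_2)<0$, and a hyperbola if $\operatorname{Re}(1-\overline{a_1}a_2)>0$. (c) If $|a_1|<1$ and $|a_2|>1$, then $\mathcal D$ is an ellipse if $\operatorname{Re}(1-\overline{a_1}a_2)\,(1-|a_1|^2|a_2|^2)<0$, and a hyperbola if $\operatorname{Re}(1-\overline{a_1}a_2)\,(1-|a_1|^2|a_2|^2)>0$. In each case, the length of the major axis (of the transverse axis, in the hyperbolic case) of $\mathcal D$ is $$|1-\overline{a_1}a_2|\sqrt{\frac{2-|a_1|^2-|a_2|^2}{1-|a_1|^2|a_2|^2}}.$$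
   Context: The plane is identified with $\mathbb C$. A central conic is an ellipse or a hyperbola in the real plane. The pair $(\mathcal C,\mathcal D)$ of conics is an $n$-Poncelet pair if, viewing the conics in $\mathbb{CP}^2$, there is a closed $n$-gon (with $n$ distinct vertices and $n$ distinct side lines) inscribed in $\mathcal C$ (vertices on $\mathcal C$) and circumscribed about $\mathcal D$ (each side line, i.e. the line through two consecutive vertices, is tangent to $\mathcal D$).
   Formalization: Existence fails in general (a1=0, a2=√3 gives axis √(−1)); a unique D is instead shown to exist iff Re(1−ā₁a₂)≠0, |a1||a2|≠1 and (2−|a1|²−|a2|²)/(1−|a1|²|a2|²)>0; (a)–(c) and the axis length are proved for every such D. *)

(* Defs.v *)
From mathcomp Require Export all_boot all_order all_algebra.
From mathcomp Require Export boolp classical_sets reals.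
From mathcomp Require Export complex.
Export ComplexField.Normc.

Set Implicit Arguments.
Unset Strict Implicit.
Unset Printing Implicit Defensive.

Import Order.TTheory GRing.Theory Num.Theory.

Local Open Scope classical_set_scope.
Local Open Scope ring_scope.

(* The real plane is R[i], and a conic of the real plane is a set of points.
   [normc z : R] is the modulus of z; the library's `|z| lives in R[i]. *)

Definition unit_circle (R : realType) : set R[i] := [set z | normc z = 1].

(* L is the length of the major axis (ellipse), resp. of the transverse axis
   (hyperbola). The strict bounds on L exclude segments, the pairs of rays
   obtained for L = normc (f1 - f2), and the perpendicular bisector obtained
   for L = 0. *)
Definition is_ellipse (R : realType) (f1 f2 : R[i]) (L : R) (D : set R[i]) :
    Prop :=
  normc (f1 - f2) < L /\
  D = [set z | normc (z - f1) + normc (z - f2) = L].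

Definition is_hyperbola (R : realType) (f1 f2 : R[i]) (L : R) (D : set R[i]) :
    Prop :=
  0 < L < normc (f1 - f2) /\
  D = [set z | `|normc (z - f1) - normc (z - f2)| = L].

Definition is_central_conic (R : realType) (f1 f2 : R[i]) (L : R)
    (D : set R[i]) : Prop :=
  is_ellipse f1 f2 L D \/ is_hyperbola f1 f2 L D.

(* Points of the projective plane over K are given by nonzero row vectors
   p = (x, y, w), and lines by the nonzero row vectors of their coefficients.
   Two nonzero row vectors u, v represent the same point (or line) iff they
   span the same row space, (u == v)%MS. *)

Definition incident (K : fieldType) (p l : 'rV[K]_3) : Prop := p *m l^T = 0.

Definition on_conic (K : fieldType) (Q : 'M[K]_3) (p : 'rV[K]_3) : Prop :=
  p *m Q *m p^T = 0.

(* The tangent line of Q at a point p of Q is the polar line of p. *)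
Definition is_tangent (K : fieldType) (Q : 'M[K]_3) (l : 'rV[K]_3) : Prop :=
  exists p : 'rV[K]_3, [/\ p != 0, on_conic Q p & (l == p *m Q)%MS].

Definition proj_distinct (K : fieldType) (n : nat) (v : 'I_n -> 'rV[K]_3) :
    Prop :=
  (forall i, v i != 0) /\ (forall i j, i != j -> ~~ (v i == v j)%MS).

(* [ordS i] is the cyclic successor of i, so that l i is the side line through
   the consecutive vertices v i and v (i + 1). *)
Definition closed_polygon (K : fieldType) (n : nat) (v l : 'I_n -> 'rV[K]_3) :
    Prop :=
  [/\ (2 < n)%N, proj_distinct v, proj_distinct l
    & forall i, incident (v i) (l i) /\ incident (v (ordS i)) (l i)].

Definition affine_point (R : realType) (z : R[i]) : 'rV[R]_3 :=
  \row_j [:: complex.Re z; complex.Im z; 1]`_j.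

Definition has_equation (R : realType) (S : set R[i]) (Q : 'M[R]_3) : Prop :=
  [/\ Q^T = Q, \det Q != 0 & S = [set z | on_conic Q (affine_point z)]].

Definition complexify (R : realType) (Q : 'M[R]_3) : 'M[R[i]]_3 :=
  map_mx (fun x : R => x%:C%C) Q.

Definition poncelet_pair (R : realType) (n : nat) (C D : set R[i]) : Prop :=
  exists QC QD : 'M[R]_3,
    [/\ has_equation C QC, has_equation D QD
      & exists v l : 'I_n -> 'rV[R[i]]_3,
          [/\ closed_polygon v l,
              forall i, on_conic (complexify QC) (v i)
            & forall i, is_tangent (complexify QD) (l i)]].

Definition poncelet_conic (R : realType) (n : nat) (f1 f2 : R[i])
    (D : set R[i]) : Prop :=
  (exists L : R, is_central_conic f1 f2 L D) /\
  poncelet_pair n (@unit_circle R) D.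

(* Main.v *)
(** In line coordinates a conic with foci [f1], [f2] and axis length [L] is
    [l(f1) l(f2) = k (p^2 + q^2) / 4] with [k = L^2 - |f1 - f2|^2], and the
    chord of the unit circle through [s] and [t] is [z + s t z' = s + t], where
    [z'] is the conjugate of [z].  Hence tangency of the chord is a symmetric
    biquadratic correspondence [v(s)^T M v(t) = 0] between the points of the
    circle, with [v(t) = (t^2, t, 1)].  If [t1 t2 t3 t4] is a 4-gon, the
    quadratic forms [M v(t1)] and [M v(t3)] have the same two roots [t2], [t4],
    hence are proportional, and [M] is singular.  Conversely, if [M] is singular
    with kernel vector [v0], the line through [v(t)] and [v0] meets the curve
    [v] again at some [v(t3)] with [M v(t3)] proportional to [M v(t)], so [t],
    [t3] and the two common roots form a 4-gon.  Finally [det M = 0] is linear in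
    [L^2] and gives the length of the axis. *)
Require Import Defs.
From mathcomp Require Import ring lra.
Set Implicit Arguments.
Unset Strict Implicit.
Unset Printing Implicit Defensive.
Import Order.TTheory GRing.Theory Num.Theory.
Local Open Scope classical_set_scope.
Local Open Scope ring_scope.

(** * Coordinates for points, lines and symmetric matrices in the projective plane *)

Definition row3 (K : fieldType) (a b c : K) : 'rV[K]_3 :=
  \row_j [:: a; b; c]`_j.

Definition sym3 (K : fieldType) (a b c d e f : K) : 'M[K]_3 :=
  \matrix_(i, j) (nth [::] [:: [:: a; d; e]; [:: d; b; f]; [:: e; f; c]] i)`_j.

Definition quadr (K : fieldType) (a b c d e f x y w : K) : K :=
  a * x ^+ 2 + b * y ^+ 2 + c * w ^+ 2
  + 2 * (d * x * y + e * x * w + f * y * w).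

Lemma sum_ord3 (V : nmodType) (F : 'I_3 -> V) : \sum_i F i = F 0 + F 1 + F 2.
Proof.
rewrite !big_ord_recl big_ord0 addr0 -addrA.
by congr (F _ + (F _ + F _)); apply: val_inj.
Qed.

Lemma ord3P (P : 'I_3 -> Prop) : P 0 -> P 1 -> P 2 -> forall i, P i.
Proof.
move=> P0 P1 P2 [[|[|[|//]]] ilt].
- by rewrite (_ : Ordinal ilt = 0) //; apply: val_inj.
- by rewrite (_ : Ordinal ilt = 1) //; apply: val_inj.
- by rewrite (_ : Ordinal ilt = 2) //; apply: val_inj.
Qed.

Section Vec3.
Variable K : fieldType.
Implicit Types (a b c x y w k : K).

Lemma row3_eta (v : 'rV[K]_3) : v = row3 (v 0 0) (v 0 1) (v 0 2).
Proof. by apply/rowP; apply: ord3P; rewrite mxE. Qed.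

Lemma row3_inj a b c x y w :
  row3 a b c = row3 x y w -> [/\ a = x, b = y & c = w].
Proof.
move=> /rowP E; split.
- by have := E 0; rewrite !mxE.
- by have := E 1; rewrite !mxE.
- by have := E 2; rewrite !mxE.
Qed.

Lemma row30 : row3 0 0 0 = 0 :> 'rV[K]_3.
Proof. by apply/rowP; apply: ord3P; rewrite !mxE. Qed.

Lemma row3_eq0 a b c : (row3 a b c == 0) = [&& a == 0, b == 0 & c == 0].
Proof.
apply/eqP/and3P => [|[/eqP-> /eqP-> /eqP->]]; last exact: row30.
by rewrite -row30 => /row3_inj[-> -> ->]; rewrite !eqxx.
Qed.

Lemma row3Z k a b c : k *: row3 a b c = row3 (k * a) (k * b) (k * c).
Proof. by apply/rowP; apply: ord3P; rewrite !mxE. Qed.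

Lemma row3_dot a b c x y w :
  row3 a b c *m (row3 x y w)^T = (a * x + b * y + c * w)%:M.
Proof.
apply/matrixP => i j; rewrite !ord1 !mxE sum_ord3 !mxE /=.
by rewrite mulr1n.
Qed.

Lemma scalar1_eq0 k : k%:M = 0 :> 'M[K]_1 <-> k = 0.
Proof.
split=> [/matrixP/(_ 0 0)|->]; last exact: raddf0.
by rewrite !mxE eqxx.
Qed.

Lemma incident_row3 x y w a b c :
  incident (row3 x y w) (row3 a b c) <-> x * a + y * b + w * c = 0.
Proof. by rewrite /incident row3_dot; exact: scalar1_eq0. Qed.

Lemma row3_sym3 x y w a b c d e f :
  row3 x y w *m sym3 a b c d e f =
  row3 (a * x + d * y + e * w) (d * x + b * y + f * w) (e * x + f * y + c * w).
Proof.
by apply/rowP; apply: ord3P; rewrite !mxE sum_ord3 !mxE /=; ring.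
Qed.

Lemma on_conic_sym3 a b c d e f x y w :
  on_conic (sym3 a b c d e f) (row3 x y w) <-> quadr a b c d e f x y w = 0.
Proof.
rewrite /on_conic row3_sym3 row3_dot; rewrite scalar1_eq0.
by have -> : quadr a b c d e f x y w = (a * x + d * y + e * w) * x +
  (d * x + b * y + f * w) * y + (e * x + f * y + c * w) * w
  by rewrite /quadr; ring.
Qed.

Lemma sym3_eta (Q : 'M[K]_3) : Q^T = Q ->
  Q = sym3 (Q 0 0) (Q 1 1) (Q 2 2) (Q 0 1) (Q 0 2) (Q 1 2).
Proof.
move=> /matrixP Qs; apply/matrixP; apply: ord3P; apply: ord3P;
  rewrite !mxE //=; by rewrite -Qs mxE.
Qed.

Lemma sym3_tr a b c d e f : (sym3 a b c d e f)^T = sym3 a b c d e f.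
Proof. by apply/matrixP; apply: ord3P; apply: ord3P; rewrite !mxE. Qed.

Lemma eqmx_scaleP (u v : 'rV[K]_3) : u != 0 -> (u == v)%MS ->
  exists2 k, k != 0 & u = k *: v.
Proof.
move=> u0 /andP[/sub_rVP[k uk] _]; exists k => //.
by apply: contra_neq u0 => k0; rewrite uk k0 scale0r.
Qed.

Lemma scale_eqmxP (u v : 'rV[K]_3) k : k != 0 -> u = k *: v -> (u == v)%MS.
Proof. by move=> k0 ->; apply/eqmxP; exact: eqmx_scale. Qed.

End Vec3.

(** * The biquadratic correspondence of tangent chords and its determinant *)

Section Correspondence.
Variable K : fieldType.
Variables f1 g1 f2 g2 kk : K.
Implicit Types (p q t x y z : K).

(* Tangency of the chord through the points [p1/q1] and [p2/q2] of the circle to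
   the conic with foci [f1], [f2]; [g1], [g2] stand for the conjugates. *)
Definition corr p1 q1 p2 q2 : K :=
  (f1 * (q1 * q2) + g1 * (p1 * p2) - (p1 * q2 + p2 * q1)) *
  (f2 * (q1 * q2) + g2 * (p1 * p2) - (p1 * q2 + p2 * q1))
  - kk * (p1 * p2) * (q1 * q2).

(* The determinant of the matrix whose rows are [corrX], [corrY], [corrZ]. *)
Definition corr_det : K :=
  (f1 * g2 + g1 * f2 + 2 - kk) * (f1 * f2 * (g1 * g2) - 1)
  - g1 * g2 * (f1 + f2) ^+ 2 - f1 * f2 * (g1 + g2) ^+ 2
  + 2 * (f1 + f2) * (g1 + g2).

Definition corrX x y z := g1 * g2 * x - (g1 + g2) * y + z.
Definition corrY x y z :=
  - (g1 + g2) * x + (f1 * g2 + g1 * f2 + 2 - kk) * y - (f1 + f2) * z.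
Definition corrZ x y z := x - (f1 + f2) * y + f1 * f2 * z.

Lemma corrE p1 q1 p2 q2 : corr p1 q1 p2 q2 =
  corrX (p1 ^+ 2) (p1 * q1) (q1 ^+ 2) * p2 ^+ 2 +
  corrY (p1 ^+ 2) (p1 * q1) (q1 ^+ 2) * (p2 * q2) +
  corrZ (p1 ^+ 2) (p1 * q1) (q1 ^+ 2) * q2 ^+ 2.
Proof. by rewrite /corr /corrX /corrY /corrZ; ring. Qed.

Lemma corrC p1 q1 p2 q2 : corr p1 q1 p2 q2 = corr p2 q2 p1 q1.
Proof. by rewrite /corr; ring. Qed.

(** Cramer's rule: the multipliers of [corrX], [corrY], [corrZ] are the entries of the adjugate
    matrix. *)
Lemma corr_det_ker x y z :
  corrX x y z = 0 -> corrY x y z = 0 -> corrZ x y z = 0 ->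
  [/\ corr_det * x = 0, corr_det * y = 0 & corr_det * z = 0].
Proof.
move=> ex ey ez.
pose P := f1 * f2; pose P' := g1 * g2; pose S := f1 + f2; pose S' := g1 + g2.
pose k := f1 * g2 + g1 * f2 + 2 - kk.
split.
- have -> : corr_det * x = (k * P - S ^+ 2) * corrX x y z +
    (S' * P - S) * corrY x y z + (S' * S - k) * corrZ x y z.
    by rewrite /corrX /corrY /corrZ /corr_det /P /P' /S /S' /k; ring.
  by rewrite ex ey ez; ring.
- have -> : corr_det * y = (S' * P - S) * corrX x y z +
    (P' * P - 1) * corrY x y z + (P' * S - S') * corrZ x y z.
    by rewrite /corrX /corrY /corrZ /corr_det /P /P' /S /S' /k; ring.
  by rewrite ex ey ez; ring.
- have -> : corr_det * z = (S' * S - k) * corrX x y z +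
    (P' * S - S') * corrY x y z + (P' * k - S' ^+ 2) * corrZ x y z.
    by rewrite /corrX /corrY /corrZ /corr_det /P /P' /S /S' /k; ring.
  by rewrite ex ey ez; ring.
Qed.

End Correspondence.

(** The two roots factor the form as [m (q1 p - p1 q) (q2 p - p2 q)]; the conclusion lists its
    coefficients. *)
Lemma binary_form_roots (K : fieldType) (a b c p1 q1 p2 q2 : K) :
  a * p1 ^+ 2 + b * (p1 * q1) + c * q1 ^+ 2 = 0 ->
  a * p2 ^+ 2 + b * (p2 * q2) + c * q2 ^+ 2 = 0 ->
  p1 * q2 - p2 * q1 != 0 ->
  exists m, [/\ a = m * (q1 * q2), b = - m * (p1 * q2 + p2 * q1)
              & c = m * (p1 * p2)].
Proof.
set E1 := (X in X = 0 -> _) => e1; set E2 := (X in X = 0 -> _) => e2 D0.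
(* [B] is twice the polar form at the two roots; for the factored form it equals
   [- m (p1 q2 - p2 q1)^2], which determines [m]. *)
pose B := 2 * (a * (p1 * p2) + c * (q1 * q2)) + b * (p1 * q2 + p2 * q1).
have D20 : (p1 * q2 - p2 * q1) ^+ 2 != 0 by rewrite expf_neq0.
exists (- B / (p1 * q2 - p2 * q1) ^+ 2); split; apply: (mulIf D20).
- have -> : a * (p1 * q2 - p2 * q1) ^+ 2 =
    - B * (q1 * q2) + q2 ^+ 2 * E1 + q1 ^+ 2 * E2.
    by rewrite /B /E1 /E2; ring.
  by rewrite e1 e2; field.
- have -> : b * (p1 * q2 - p2 * q1) ^+ 2 =
    B * (p1 * q2 + p2 * q1) - 2 * p2 * q2 * E1 - 2 * p1 * q1 * E2.
    by rewrite /B /E1 /E2; ring.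
  by rewrite e1 e2; field.
- have -> : c * (p1 * q2 - p2 * q1) ^+ 2 =
    - B * (p1 * p2) + p2 ^+ 2 * E1 + p1 ^+ 2 * E2.
    by rewrite /B /E1 /E2; ring.
  by rewrite e1 e2; field.
Qed.

(** If the determinant were nonzero, the kernel vector [m3 v(t1) - m1 v(t3)] would vanish. As
    [v(t1)] and [v(t3)] are independent, [m1 = 0], so [M v(t1) = 0] and then [v(t1) = 0], which is
    absurd. *)
Lemma corr_cycle_det (K : fieldType) (f1 g1 f2 g2 kk : K)
    (p1 q1 p2 q2 p3 q3 p4 q4 : K) :
  let F := corr f1 g1 f2 g2 kk in
  F p1 q1 p2 q2 = 0 -> F p2 q2 p3 q3 = 0 -> F p3 q3 p4 q4 = 0 ->
  F p4 q4 p1 q1 = 0 ->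
  p1 * q3 - p3 * q1 != 0 -> p2 * q4 - p4 * q2 != 0 ->
  corr_det f1 g1 f2 g2 kk = 0.
Proof.
move=> F F12 F23 F34 F41 D13 D24.
rewrite /F corrC in F23; rewrite /F corrC in F41.
move: F12 F23 F34 F41; rewrite /F !corrE => F12 F32 F34 F14.
have [m1 [X1 Y1 Z1]] := binary_form_roots F12 F14 D24.
have [m3 [X3 Y3 Z3]] := binary_form_roots F32 F34 D24.
apply: contraTeq isT => D0.
have comb a b c : corr_det f1 g1 f2 g2 kk * a = 0 ->
    corr_det f1 g1 f2 g2 kk * b = 0 ->
    corr_det f1 g1 f2 g2 kk * c = 0 -> [/\ a = 0, b = 0 & c = 0].
  by move=> /eqP + /eqP + /eqP; rewrite !mulf_eq0 (negPf D0) /=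
    => /eqP-> /eqP-> /eqP->.
have D13' : (p1 * q3 - p3 * q1) ^+ 2 != 0 by rewrite expf_neq0.
pose x := m3 * p1 ^+ 2 - m1 * p3 ^+ 2.
pose y := m3 * (p1 * q1) - m1 * (p3 * q3).
pose z := m3 * q1 ^+ 2 - m1 * q3 ^+ 2.
have [|||Dx Dy Dz] := @corr_det_ker K f1 g1 f2 g2 kk x y z.
- have -> : corrX g1 g2 x y z =
    m3 * corrX g1 g2 (p1 ^+ 2) (p1 * q1) (q1 ^+ 2)
    - m1 * corrX g1 g2 (p3 ^+ 2) (p3 * q3) (q3 ^+ 2).
    by rewrite /corrX /x /y /z; ring.
  by rewrite X1 X3; ring.
- have -> : corrY f1 g1 f2 g2 kk x y z =
    m3 * corrY f1 g1 f2 g2 kk (p1 ^+ 2) (p1 * q1) (q1 ^+ 2)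
    - m1 * corrY f1 g1 f2 g2 kk (p3 ^+ 2) (p3 * q3) (q3 ^+ 2).
    by rewrite /corrY /x /y /z; ring.
  by rewrite Y1 Y3; ring.
- have -> : corrZ f1 f2 x y z =
    m3 * corrZ f1 f2 (p1 ^+ 2) (p1 * q1) (q1 ^+ 2)
    - m1 * corrZ f1 f2 (p3 ^+ 2) (p3 * q3) (q3 ^+ 2).
    by rewrite /corrZ /x /y /z; ring.
  by rewrite Z1 Z3; ring.
have [x0 y0 z0] := comb _ _ _ Dx Dy Dz.
(* The functional [(q1^2, -2 p1 q1, p1^2)] kills [v(t1)] and takes the value [(p1 q3 - p3 q1)^2] at
   [v(t3)]. *)
have m1_0 : m1 = 0.
  apply: (mulIf D13').
  have -> : m1 * (p1 * q3 - p3 * q1) ^+ 2 =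
    - q1 ^+ 2 * x + 2 * (p1 * q1) * y - p1 ^+ 2 * z by rewrite /x /y /z; ring.
  by rewrite x0 y0 z0; ring.
rewrite m1_0 !mul0r oppr0 mul0r in X1 Y1 Z1.
have [Dx1 Dy1 Dz1] := corr_det_ker X1 Y1 Z1.
have [/eqP p10 _ /eqP q10] := comb _ _ _ Dx1 Dy1 Dz1.
move: p10 q10 D13; rewrite !expf_eq0 /= => /eqP-> /eqP->.
by rewrite mul0r mulr0 subrr eqxx.
Qed.

(** * Construction of a 4-cycle from a singular correspondence *)

Lemma disc_eq0_root (K : numDomainType) (A B C : {poly K}) (x : K) :
  B ^+ 2 - 4%:P * A * C = 0 -> C.[x] = 0 -> A.[x] * C^`().[x] = 0.
Proof.
move=> D0 C0; have hE (p : {poly K}) : p = 0 -> p.[x] = 0.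
  by move->; rewrite horner0.
have B0 : B.[x] = 0.
  move: (hE _ D0); rewrite hornerD hornerN !hornerM C0 mulr0 subr0.
  by move/eqP; rewrite mulf_eq0 orbb => /eqP.
(* Since [B] and [C] both vanish at [x], the derivative of [B^2 - 4 A C] there reduces to
   [-4 A C']. *)
have /hE : (B ^+ 2 - 4%:P * A * C)^`() = 0 by rewrite D0 deriv0.
rewrite expr2 derivB !derivM derivC !(hornerD, hornerN, hornerM, hornerC).
rewrite C0 B0 [X in X = 0](_ : _ = - 4 * (A.[x] * C^`().[x])); last by ring.
by move/eqP; rewrite mulf_eq0 oppr_eq0 pnatr_eq0 => /eqP.
Qed.

Lemma horner_quadratic (K : comNzRingType) (A B C : {poly K}) (x : K) :
  (A * 'X ^+ 2 + B * 'X + C).[x] = A.[x] * x ^+ 2 + B.[x] * x + C.[x].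
Proof. by rewrite !hornerD !hornerM hornerX. Qed.

Lemma horner_disc (K : comNzRingType) (A B C : {poly K}) (x : K) :
  (B ^+ 2 - 4%:P * A * C).[x] = B.[x] ^+ 2 - 4 * A.[x] * C.[x].
Proof. by rewrite hornerD hornerN !hornerM hornerC. Qed.

Section Sufficiency.
Variable K : numClosedFieldType.
Variables f1 g1 f2 g2 kk : K.
(* The kernel of a singular correspondence is spanned by [(x0, y0, z0)]. *)
Let x0 := f1 + f2 - (g1 + g2) * (f1 * f2).
Let y0 := 1 - f1 * f2 * (g1 * g2).
Let z0 := g1 + g2 - g1 * g2 * (f1 + f2).

(* [y0^2 - x0 z0] is the resultant of the outer coefficients of [corr], whose
   roots are [f1, f2] and [1/g1, 1/g2]. *)
Lemma corr_pole_neq0 :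
  f1 * g1 != 1 -> f1 * g2 != 1 -> f2 * g1 != 1 -> f2 * g2 != 1 ->
  y0 ^+ 2 - x0 * z0 != 0.
Proof.
have -> : y0 ^+ 2 - x0 * z0 =
  (1 - f1 * g1) * (1 - f1 * g2) * (1 - f2 * g1) * (1 - f2 * g2).
  by rewrite /x0 /y0 /z0; ring.
by move=> *; rewrite !mulf_neq0 // subr_eq0 eq_sym.
Qed.

(* The projection from [(x0, y0, z0)] swaps [t] and
   [(y0 t - x0) / (z0 t - y0)]. *)
Lemma corr_involution t p q : corr_det f1 g1 f2 g2 kk = 0 ->
  corr f1 g1 f2 g2 kk (y0 * t - x0) (z0 * t - y0) p q =
  (y0 ^+ 2 - x0 * z0) * corr f1 g1 f2 g2 kk t 1 p q.
Proof.
move=> D0; apply/eqP; rewrite -subr_eq0; apply/eqP.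
transitivity (corr_det f1 g1 f2 g2 kk *
   (- (z0 * t ^+ 2 - 2 * y0 * t + x0) * (p * q))).
  by rewrite /corr /corr_det /x0 /y0 /z0; ring.
by rewrite D0 mul0r.
Qed.

(** The coefficients of [corr] as a quadratic in its second point, seen as polynomials in the
    first. *)
Let polA : {poly K} := (g1 *: 'X - 1) * (g2 *: 'X - 1).
Let polC : {poly K} := ('X - f1%:P) * ('X - f2%:P).
Let polB : {poly K} := (f1%:P - 'X) * (g2 *: 'X - 1) +
  (f2%:P - 'X) * (g1 *: 'X - 1) - kk *: 'X.

Let polAE t : polA.[t] = (g1 * t - 1) * (g2 * t - 1).
Proof. by rewrite /polA !hornerE. Qed.

Let polBE t : polB.[t] =
  (f1 - t) * (g2 * t - 1) + (f2 - t) * (g1 * t - 1) - kk * t.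
Proof. by rewrite /polB !hornerE. Qed.

Let polCE t : polC.[t] = (t - f1) * (t - f2).
Proof. by rewrite /polC !hornerE. Qed.

Let corr_horner t s : corr f1 g1 f2 g2 kk t 1 s 1 =
  polA.[t] * s ^+ 2 + polB.[t] * s + polC.[t].
Proof. by rewrite polAE polBE polCE /corr; ring. Qed.

(** [f1] is a simple root of [polC] and no root of [polA], which [disc_eq0_root] forbids for a zero
    discriminant. Hence a generic point has two distinct neighbours. *)
Lemma corr_disc_neq0 :
  f1 != f2 -> f1 * g1 != 1 -> f1 * g2 != 1 ->
  polB ^+ 2 - 4%:P * polA * polC != 0.
Proof.
move=> f12 n1 n2; apply/eqP => D0.
have C0 : polC.[f1] = 0 by rewrite polCE subrr mul0r.
move: (disc_eq0_root D0 C0).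
have -> : polC^`() = ('X - f2%:P) + ('X - f1%:P).
  by rewrite /polC derivM !derivXsubC mul1r mulr1.
rewrite polAE hornerD !hornerXsubC subrr addr0 => /eqP.
rewrite !mulf_eq0 !subr_eq0 (negPf f12) orbF.
by rewrite ![_ * f1]mulrC (negPf n1) (negPf n2).
Qed.

(** A generic [t] works: its image [t3] under the involution has the same two neighbours [t2], [t4],
    and every degeneracy of the 4-gon is the vanishing at [t] of a nonzero polynomial. *)
Lemma corr_cycle_exists :
  f1 != f2 -> f1 * g1 != 1 -> f1 * g2 != 1 -> f2 * g1 != 1 -> f2 * g2 != 1 ->
  y0 != 0 -> corr_det f1 g1 f2 g2 kk = 0 ->
  let F t s := corr f1 g1 f2 g2 kk t 1 s 1 in
  exists t1 t2 t3 t4, uniq [:: t1; t2; t3; t4] /\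
    [/\ F t1 t2 = 0, F t2 t3 = 0, F t3 t4 = 0 & F t4 t1 = 0].
Proof.
move=> f12 n11 n12 n21 n22 y0N D0 F.
have l0 := corr_pole_neq0 n11 n12 n21 n22.
pose pG : {poly K} := polA * 'X ^+ 2 + polB * 'X + polC.
pose pN : {poly K} := z0%:P * 'X ^+ 2 + (- (2 * y0))%:P * 'X + x0%:P.
have NE s : pN.[s] = z0 * s ^+ 2 - 2 * y0 * s + x0.
  by rewrite horner_quadratic !hornerC mulNr.
pose pM : {poly K} := z0%:P * 'X - y0%:P.
have ME s : pM.[s] = z0 * s - y0.
  by rewrite hornerD hornerN hornerM !hornerC hornerX.
have pA0 : polA != 0.
  apply: contraTneq isT => p0; have : polA.[0] = 0 by rewrite p0 horner0.
  by rewrite /polA !hornerE => /eqP; rewrite mulrNN mulr1 oner_eq0.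
have pM0 : pM != 0.
  apply: contraTneq isT => p0; have : pM.[0] = 0 by rewrite p0 horner0.
  by rewrite ME mulr0 sub0r => /eqP; rewrite oppr_eq0 (negPf y0N).
have pN0 : pN != 0.
  apply: contraTneq isT => p0.
  have : pN.[1] - pN.[-1] = 0 by rewrite p0 !horner0 subrr.
  rewrite !NE.
  rewrite [X in X = 0](_ : _ = - 4 * y0); last by ring.
  by move/eqP; rewrite mulf_eq0 oppr_eq0 pnatr_eq0 (negPf y0N).
have GE t : pG.[t] = F t t by rewrite /F corr_horner -horner_quadratic.
have pG0 : pG != 0.
  apply: contraTneq isT => p0.
  have F0 t : F t t = 0 by rewrite -GE p0 horner0.
  have P0 : f1 * f2 = 0 by rewrite -(F0 0) /F /corr; ring.
  have S0 : f1 + f2 = 0.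
    (* The odd part of [F t t] is [-2 (f1 + f2) t - 2 (g1 + g2) t^3]. *)
    have : 24 * (f1 + f2) = F 2 2 - F (-2) (-2) - 8 * (F 1 1 - F (-1) (-1)).
      by rewrite /F /corr; ring.
    rewrite !F0 !(subr0, mulr0) => /eqP.
    by rewrite mulf_eq0 pnatr_eq0 /= => /eqP.
  move/eqP: S0; rewrite addr_eq0 => /eqP f1N; move/eqP: f12; case.
  move: P0; rewrite f1N => /eqP; rewrite mulf_eq0 oppr_eq0 orbb => /eqP->.
  by rewrite oppr0.
have pD0 := corr_disc_neq0 f12 n11 n12.
(* In order, the factors make the equation for the neighbours quadratic, [t3] finite, [t3] different
   from [t], [t] unrelated to itself, and the two neighbours distinct. *)
have /closed_nonrootP[t] : polA * pM * pN * pG *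
    (polB ^+ 2 - 4%:P * polA * polC) != 0.
  by do 4![apply: mulf_neq0 => //].
rewrite 4!rootM 4!negb_or !/root => /andP[/andP[/andP[/andP[At Mt] Nt] Gt] Dt].
have Dt' : polB.[t] ^+ 2 - 4 * polA.[t] * polC.[t] != 0.
  by move: Dt; rewrite horner_disc.
have Mt' : z0 * t - y0 != 0 by rewrite -ME.
have Nt' : z0 * t ^+ 2 - 2 * y0 * t + x0 != 0.
  by rewrite -NE.
have Gt' : F t t != 0 by rewrite -GE.
move: (polA.[t]) (polB.[t]) (polC.[t]) (corr_horner t) At Dt'.
move=> A B C FE At Dt'.
pose r := sqrtC (B ^+ 2 - 4 * A * C).
have r2 : r ^+ 2 = B ^+ 2 - 4 * A * C by rewrite sqrtCK.
have r0 : r != 0 by rewrite sqrtC_eq0.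
have sol e : e ^+ 2 = 1 -> F t ((- B + e * r) / (2 * A)) = 0.
  move=> e2; rewrite /F FE.
  rewrite [LHS](_ : _ = (e ^+ 2 * r ^+ 2 - B ^+ 2 + 4 * A * C) / (4 * A)).
    by rewrite e2 r2; ring.
  by field.
pose t3 := (y0 * t - x0) / (z0 * t - y0).
(* [corr] is homogeneous of degree 2 in its first point, so passing from [(y0 t - x0, z0 t - y0)] to
   [(t3, 1)] costs the squared denominator. *)
have F3 s : F t3 s * (z0 * t - y0) ^+ 2 = (y0 ^+ 2 - x0 * z0) * F t s.
  rewrite -(corr_involution _ _ _ D0) /F /t3 /corr.
  by field.
have F30 s : F t s = 0 -> F t3 s = 0.
  move=> Fts; apply: (mulIf (expf_neq0 2 Mt')).
  by rewrite F3 Fts mulr0 mul0r.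
have Fsym s u : F s u = F u s by exact: corrC.
pose t2 := (- B + r) / (2 * A); pose t4 := (- B - r) / (2 * A).
have Ft2 : F t t2 = 0 by have := sol 1 (expr1n _ _); rewrite mul1r.
have Ft4 : F t t4 = 0.
  by have := sol (-1); rewrite sqrrN expr1n mulN1r => ->.
have F33 : F t3 t != 0.
  by apply: contra_neq (mulf_neq0 l0 Gt'); rewrite -F3 => ->; rewrite mul0r.
exists t, t2, t3, t4; split; last first.
  by rewrite [F t2 t3]Fsym [F t4 t]Fsym; split=> //; exact: F30.
(* The neighbours of [t] differ from [t] and from [t3], since neither of these is related to [t]. *)
have nt (s u w : K) : F s u = 0 -> F s w != 0 -> w != u.
  by move=> F0; apply: contra_neq => ->.
have t13 : t != t3.
  apply: contraNneq Nt' => e; apply/eqP.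
  have : t * (z0 * t - y0) = y0 * t - x0 by rewrite {1}e /t3 divfK.
  by move/eqP; rewrite -subr_eq0 => /eqP <-; ring.
have t24 : t2 != t4.
  rewrite -subr_eq0 (_ : _ - _ = r / A); first by rewrite mulf_neq0 ?invr_eq0.
  by rewrite /t2 /t4; field.
have t12 := nt _ _ _ Ft2 Gt'; have t14 := nt _ _ _ Ft4 Gt'.
have F13 : F t t3 != 0 by rewrite Fsym.
have t32 := nt _ _ _ Ft2 F13; have t34 := nt _ _ _ Ft4 F13.
by rewrite /= !inE !negb_or t12 t13 t14 t24 t34 eq_sym t32.
Qed.
End Sufficiency.

(** * Tangent lines as points of the dual conic, and conics with given foci *)

Section Tangency.
Variables (K : fieldType) (Q G : 'M[K]_3) (s : K).
Hypotheses (Qsym : Q^T = Q) (Gsym : G^T = G) (s0 : s != 0).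
Hypothesis QG : Q *m G = s%:M.

(** As [G] is [s] times the inverse of [Q], the maps [p -> p Q] and [l -> l G] are inverse up to
    [s]; they carry the points of [Q] to the lines on [G] and back. *)
Lemma is_tangent_dual (l : 'rV[K]_3) :
  is_tangent Q l <-> l != 0 /\ on_conic G l.
Proof.
have GQ : G *m Q = s%:M.
  by rewrite -[G]trmxK -[Q]trmxK -trmx_mul Qsym Gsym QG tr_scalar_mx.
split=> [[p [p0 pQ /andP[lp pl]]]|[l0 lG]].
  have pQ0 : p *m Q != 0.
    apply: contra_neq p0 => pQ0; apply/eqP; have := congr1 (mulmx^~ G) pQ0.
    rewrite -mulmxA QG mul0mx mul_mx_scalar => /eqP.
    by rewrite scaler_eq0 (negPf s0).
  split; first by apply: contra_neq pQ0 => l0; have [k ->] := sub_rVP pl;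
    rewrite l0 scaler0.
  have [k ->] := sub_rVP lp; rewrite /on_conic linearZ /= trmx_mul Qsym.
  rewrite -!scalemxAl -scalemxAr -!mulmxA [G *m _]mulmxA GQ.
  rewrite mul_scalar_mx -!scalemxAr.
  by move: pQ; rewrite /on_conic -mulmxA => ->; rewrite !scaler0.
have lGQ : l *m G *m Q = s *: l by rewrite -mulmxA GQ mul_mx_scalar.
exists (l *m G); split.
- by apply: contra_neq l0 => lG0; apply/eqP; move/eqP: lGQ;
    rewrite lG0 mul0mx eq_sym scaler_eq0 (negPf s0).
- by rewrite /on_conic lGQ trmx_mul Gsym -scalemxAl mulmxA
    (lG : _ *m _ *m _ = 0) scaler0.
- by rewrite lGQ; apply/andP; rewrite !(eqmx_scale _ s0).
Qed.

End Tangency.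

(* Four times the line conic [l(f1) l(f2) = k / 4 (l_x^2 + l_y^2)]. *)
Definition dual_conic (K : fieldType) (x1 y1 x2 y2 k : K) : 'M[K]_3 :=
  sym3 (4 * (x1 * x2) - k) (4 * (y1 * y2) - k) 4
       (2 * (x1 * y2 + x2 * y1)) (2 * (x1 + x2)) (2 * (y1 + y2)).

(* The equation [L^4 - 2 L^2 (r1^2 + r2^2) + (r1^2 - r2^2)^2 = 0], where [r1]
   and [r2] are the distances to the foci; it is quadratic since [r1^2 - r2^2]
   is affine. *)
Definition focal_conic (K : fieldType) (x1 y1 x2 y2 L : K) : 'M[K]_3 :=
  let dx := x1 - x2 in let dy := y1 - y2 in
  let de := x1 ^+ 2 + y1 ^+ 2 - x2 ^+ 2 - y2 ^+ 2 in
  let m := x1 ^+ 2 + y1 ^+ 2 + x2 ^+ 2 + y2 ^+ 2 in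
  sym3 (4 * (dx ^+ 2 - L ^+ 2)) (4 * (dy ^+ 2 - L ^+ 2))
       (L ^+ 4 - 2 * L ^+ 2 * m + de ^+ 2) (4 * dx * dy)
       (2 * (L ^+ 2 * (x1 + x2) - dx * de))
       (2 * (L ^+ 2 * (y1 + y2) - dy * de)).

(** Through [is_tangent_dual] this turns tangency to a focal conic into the line equation, whenever
    [4 L^2 k] is nonzero. *)
Lemma focal_conic_dual (K : fieldType) (x1 y1 x2 y2 L : K) :
  let k := L ^+ 2 - (x1 - x2) ^+ 2 - (y1 - y2) ^+ 2 in
  focal_conic x1 y1 x2 y2 L *m dual_conic x1 y1 x2 y2 k
  = (4 * L ^+ 2 * k)%:M.
Proof.
apply/matrixP; apply: ord3P; apply: ord3P; rewrite !mxE sum_ord3 !mxE /=;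
  by rewrite ?mulr1n ?mulr0n; ring.
Qed.

(** * Points and chords of the complexified unit circle *)

Section CircleGeometry.
Variable C : numClosedFieldType.
Implicit Types (p q x y w : C).

(* The point with [x + iy = p/q] and [x - iy = q/p], up to the factor [2pq]. *)
Definition circle_point p q : 'rV[C]_3 :=
  row3 (p ^+ 2 + q ^+ 2) ('i * (q ^+ 2 - p ^+ 2)) (2 * (p * q)).

(* The line [al (x + iy) + be (x - iy) + ga = 0]. *)
Definition complex_line (al be ga : C) : 'rV[C]_3 :=
  row3 (al + be) ('i * (al - be)) ga.

Definition chord p1 q1 p2 q2 : 'rV[C]_3 :=
  complex_line (q1 * q2) (p1 * p2) (- (p1 * q2 + p2 * q1)).

Let i2 : 'i ^+ 2 = -1 :> C := sqrCi C.

Lemma circle_point_incident p q al be ga :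
  incident (circle_point p q) (complex_line al be ga) <->
  al * p ^+ 2 + ga * (p * q) + be * q ^+ 2 = 0.
Proof.
rewrite incident_row3 [X in X = 0](_ : _ = (p ^+ 2 + q ^+ 2) * (al + be) +
  'i ^+ 2 * (q ^+ 2 - p ^+ 2) * (al - be) + 2 * (p * q) * ga); last by ring.
rewrite i2 [X in X = 0](_ : _ =
  2 * (al * p ^+ 2 + ga * (p * q) + be * q ^+ 2)); last by ring.
by split=> [/eqP|->]; rewrite ?mulr0 // mulf_eq0 pnatr_eq0 => /eqP.
Qed.

(** [p] and [q] are square roots of [(x + iy) / 2] and [(x - iy) / 2]. The sign of [q] is fixed by
    [w = 2 p q], hence the division by [p] when [p] is nonzero. *)
Lemma circle_pointP x y w : x ^+ 2 + y ^+ 2 = w ^+ 2 ->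
  exists p q, row3 x y w = circle_point p q.
Proof.
move=> xyw; pose z := (x + 'i * y) / 2; pose z' := (x - 'i * y) / 2.
have zz' : 4 * (z * z') = w ^+ 2.
  rewrite /z /z' -xyw.
  rewrite [LHS](_ : _ = x ^+ 2 - 'i ^+ 2 * y ^+ 2); last by field.
  by rewrite i2; ring.
have [p [q [pz qz' pqw]]] :
    exists p q, [/\ p ^+ 2 = z, q ^+ 2 = z' & 2 * (p * q) = w].
  have [z0|z0] := eqVneq z 0.
    exists 0, (sqrtC z'); rewrite expr0n /= z0 sqrtCK; split=> //.
    have -> : w = 0 by apply/eqP; rewrite -sqrf_eq0 -zz' z0 mul0r mulr0.
    by rewrite mul0r mulr0.
  have p0 : sqrtC z != 0 by rewrite sqrtC_eq0.
  exists (sqrtC z), (w / (2 * sqrtC z)); rewrite sqrtCK; split=> //.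
    rewrite expr_div_n exprMn sqrtCK -zz'.
    by field.
  by field.
exists p, q; rewrite /circle_point pz qz' pqw /z /z'.
congr row3; first by field.
rewrite [RHS](_ : _ = - 'i ^+ 2 * y); last by field.
by rewrite i2; ring.
Qed.

Lemma circle_point_eqmx p q p' q' :
  circle_point p q != 0 -> circle_point p' q' != 0 -> p * q' - p' * q = 0 ->
  (circle_point p q == circle_point p' q')%MS.
Proof.
move=> v0 v'0 /eqP; rewrite subr_eq0 => /eqP pq.
have [k [pk qk]] : exists k, p = k * p' /\ q = k * q'.
  have [p0|p0] := eqVneq p' 0; last first.
    exists (p / p'); rewrite divfK //; split=> //.
    by apply: (mulIf p0); rewrite mulrAC divfK // mulrC -pq mulrC.
  have q0 : q' != 0.
    apply: contra_neq v'0 => q0; rewrite /circle_point p0 q0 expr0n /=.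
    by rewrite subrr !mulr0 addr0 row30.
  exists (q / q'); rewrite divfK // p0 mulr0; split=> //.
  by apply: (mulIf q0); rewrite pq p0 !mul0r.
have k0 : k != 0.
  apply: contra_neq v0 => k0; rewrite /circle_point pk qk k0 !mul0r expr0n /=.
  by rewrite subrr !mulr0 addr0 row30.
apply: (@scale_eqmxP _ _ _ (k ^+ 2)); first by rewrite expf_neq0.
by rewrite /circle_point row3Z pk qk; congr row3; ring.
Qed.

(** On the circle the equation of the line becomes a binary quadratic form whose roots are the two
    given points, so [binary_form_roots] fixes it up to a factor. *)
Lemma chordP p1 q1 p2 q2 (l : 'rV[C]_3) :
  p1 * q2 - p2 * q1 != 0 ->
  incident (circle_point p1 q1) l -> incident (circle_point p2 q2) l ->
  exists m, l = m *: chord p1 q1 p2 q2.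
Proof.
move=> D0.
have -> : l = complex_line ((l 0 0 - 'i * l 0 1) / 2)
                           ((l 0 0 + 'i * l 0 1) / 2) (l 0 2).
  rewrite [LHS]row3_eta; congr row3; first by field.
  rewrite [RHS](_ : _ = - 'i ^+ 2 * l 0 1); last by field.
  by rewrite i2; ring.
move=> /circle_point_incident e1 /circle_point_incident e2.
have [m [-> -> ->]] := binary_form_roots e1 e2 D0.
by exists m; rewrite /chord /complex_line row3Z; congr row3; ring.
Qed.

Lemma chord_incident p1 q1 p2 q2 :
  incident (circle_point p1 q1) (chord p1 q1 p2 q2) /\
  incident (circle_point p2 q2) (chord p1 q1 p2 q2).
Proof. by split; apply/circle_point_incident; ring. Qed.

Section Dual.
Variables x1 y1 x2 y2 k : C.
Let F := corr (x1 + 'i * y1) (x1 - 'i * y1) (x2 + 'i * y2) (x2 - 'i * y2) k.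

(** For a chord, [l(f)] is [f q1 q2 + g p1 p2 - (p1 q2 + p2 q1)] and [l_x^2 + l_y^2] is
    [4 p1 p2 q1 q2], so the scaled line equation is four times [corr]. *)
Lemma on_dual_chord p1 q1 p2 q2 :
  on_conic (dual_conic x1 y1 x2 y2 k) (chord p1 q1 p2 q2) <->
  F p1 q1 p2 q2 = 0.
Proof.
rewrite on_conic_sym3.
set X := quadr _ _ _ _ _ _ _ _ _.
(* The multiple of ['i ^+ 2 + 1] makes this an identity of polynomials in which ['i] is a free
   variable. *)
have -> : X = 4 * F p1 q1 p2 q2 +
    ('i ^+ 2 + 1) * - k * (q1 * q2 - p1 * p2) ^+ 2.
  by rewrite /X /F /quadr /corr; ring.
rewrite i2 addNr !mul0r addr0.
by split=> [/eqP|->]; rewrite ?mulr0 // mulf_eq0 pnatr_eq0 => /eqP.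
Qed.

Lemma polygon_corr_det (v l : 'I_4 -> 'rV[C]_3) :
  closed_polygon v l -> (forall i, on_conic (sym3 1 1 (-1) 0 0 0) (v i)) ->
  (forall i, on_conic (dual_conic x1 y1 x2 y2 k) (l i)) ->
  corr_det (x1 + 'i * y1) (x1 - 'i * y1) (x2 + 'i * y2) (x2 - 'i * y2) k = 0.
Proof.
move=> [_ [v0 vD] [l0 _] inc] vC lG.
have /choice[pq vE] i : exists pq : C * C, v i = circle_point pq.1 pq.2.
  have := vC i; rewrite [v i]row3_eta on_conic_sym3 /quadr.
  rewrite [X in X = 0](_ : _ =
    (v i 0 0) ^+ 2 + (v i 0 1) ^+ 2 - (v i 0 2) ^+ 2); last by ring.
  by move/eqP; rewrite subr_eq0 => /eqP/circle_pointP[p [q E]]; exists (p, q).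
pose p i := (pq i).1; pose q i := (pq i).2.
have D i j : i != j -> p i * q j - p j * q i != 0.
  move=> ij; apply: contra (vD i j ij) => /eqP E; move: (v0 i) (v0 j).
  by rewrite !vE => vi vj; apply: circle_point_eqmx.
(* A side is a nonzero multiple of the chord of its two vertices, so lying on the dual conic becomes
   the relation [F]. *)
have Fi i j : j = ordS i -> i != j -> F (p i) (q i) (p j) (q j) = 0.
  move=> -> ij; have [] := inc i; rewrite !vE => inc1 inc2.
  have [m lE] := chordP (D _ _ ij) inc1 inc2.
  have m0 : m != 0.
    by apply: contraNneq (l0 i) => m0; rewrite lE m0 scale0r.
  apply/on_dual_chord; have := lG i; rewrite lE /on_conic linearZ /=.
  rewrite -!scalemxAl -scalemxAr => /eqP.
  by rewrite !scaler_eq0 (negPf m0) => /eqP.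
apply: (@corr_cycle_det _ _ _ _ _ _
  (p 0) (q 0) (p 1) (q 1) (p 2) (q 2) (p 3) (q 3)).
- by apply: Fi => //; apply: val_inj.
- by apply: Fi => //; apply: val_inj.
- by apply: Fi => //; apply: val_inj.
- by apply: Fi => //; apply: val_inj.
- exact: D.
- exact: D.
Qed.

End Dual.

Lemma circle_point_on_circle p q :
  on_conic (sym3 1 1 (-1) 0 0 0) (circle_point p q).
Proof.
rewrite on_conic_sym3 /quadr [LHS](_ : _ =
  ('i ^+ 2 + 1) * (q ^+ 2 - p ^+ 2) ^+ 2); last by ring.
by rewrite i2 addNr mul0r.
Qed.

Lemma circle_point1_neq0 p : circle_point p 1 != 0.
Proof.
rewrite row3_eq0; apply/negP => /and3P[+ _]; rewrite !mulf_eq0 pnatr_eq0.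
rewrite oner_eq0 orbF /= => + /eqP p0.
by rewrite p0 expr0n add0r expr1n oner_eq0.
Qed.

Lemma circle_point1_inj p q :
  (circle_point p 1 == circle_point q 1)%MS -> p = q.
Proof.
move=> /eqmx_scaleP[|k _]; first exact: circle_point1_neq0.
rewrite row3Z => /row3_inj[e1 e2 e3].
have {}e3 : p = k * q.
  apply: (mulfI (x := 2)); first by rewrite pnatr_eq0.
  by move: e3; rewrite !mulr1 => ->; ring.
(* Both vectors have [x - iy = 2], which forces the factor to be 1. *)
have k1 : k = 1.
  have : 2 * (k - 1) =
    ('i ^+ 2 + 1) * (p ^+ 2 - 1) + k * ('i ^+ 2 + 1) * (1 - q ^+ 2).
    have -> : ('i ^+ 2 + 1) * (p ^+ 2 - 1) + k * ('i ^+ 2 + 1) * (1 - q ^+ 2) =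
      (p ^+ 2 + 1 ^+ 2) - 'i * ('i * (1 ^+ 2 - p ^+ 2)) - k * (q ^+ 2 + 1 ^+ 2)
      + 'i * (k * ('i * (1 ^+ 2 - q ^+ 2))) + 2 * (k - 1) by ring.
    by rewrite e1 e2; ring.
  rewrite i2 addNr mulr0 !mul0r addr0 => /eqP.
  by rewrite mulf_eq0 pnatr_eq0 subr_eq0 => /eqP.
by rewrite e3 k1 mul1r.
Qed.

(** Both chords have coefficient 1 at [x + iy], so proportional ones are equal and their endpoints
    have the same sum and product. *)
Lemma chord1_eqmx p1 p2 q1 q2 :
  (chord p1 1 p2 1 == chord q1 1 q2 1)%MS -> p1 = q1 \/ p1 = q2.
Proof.
move=> /andP[_ /sub_rVP[k]]; rewrite /chord /complex_line row3Z !mulr1.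
move=> /row3_inj[e1 e2 e3].
have e2' : 1 - q1 * q2 = k * (1 - p1 * p2).
  by apply: (mulfI (neq0Ci C)); rewrite e2; ring.
have k1 : k = 1.
  apply: (mulfI (x := 2)); first by rewrite pnatr_eq0.
  have -> : 2 * k = k * (1 + p1 * p2) + k * (1 - p1 * p2) by ring.
  by rewrite -e1 -e2'; ring.
have : (p1 - q1) * (p1 - q2) = 0.
  have -> : (p1 - q1) * (p1 - q2) =
    p1 ^+ 2 + p1 * (- (q1 + q2)) + ((1 + q1 * q2) - 1) by ring.
  by rewrite e3 e1 k1; ring.
by move/eqP; rewrite mulf_eq0 !subr_eq0 => /orP[] /eqP; [left|right].
Qed.

Lemma chord1_neq0 p q : chord p 1 q 1 != 0.
Proof.
rewrite /chord /complex_line; apply/eqP; rewrite -row30 !mulr1.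
move=> /row3_inj[e1 /eqP + _].
rewrite mulf_eq0 (negPf (neq0Ci C)) /= => /eqP e2.
have /eqP : (2 : C) = 0 by rewrite -[RHS]addr0 -{1}e1 -e2; ring.
by rewrite pnatr_eq0.
Qed.

Lemma corr_cycle_polygon (x1 y1 x2 y2 k : C) (t : 'I_4 -> C) :
  injective t ->
  (forall i, corr (x1 + 'i * y1) (x1 - 'i * y1) (x2 + 'i * y2) (x2 - 'i * y2) k
    (t i) 1 (t (ordS i)) 1 = 0) ->
  exists v l : 'I_4 -> 'rV[C]_3,
    [/\ closed_polygon v l,
        forall i, on_conic (sym3 1 1 (-1) 0 0 0) (v i),
        forall i, l i != 0
      & forall i, on_conic (dual_conic x1 y1 x2 y2 k) (l i)].
Proof.
move=> tI Ft.
have tS i : t i != t (ordS i).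
  by rewrite (inj_eq tI); case: i => [[|[|[|[|//]]]] ?].
exists (fun i => circle_point (t i) 1), (fun i => chord (t i) 1 (t (ordS i)) 1).
have l0 i := chord1_neq0 (t i) (t (ordS i)).
split=> //; last 2 first.
- by move=> i; exact: circle_point_on_circle.
- by move=> i; apply/on_dual_chord.
split=> //; last by move=> i; exact: chord_incident.
- split=> [i|i j ij]; first exact: circle_point1_neq0.
  by apply: contra ij => /circle_point1_inj/tI ->.
- split=> // i j; apply: contra => E; apply/eqP.
  (* If two different sides coincide, the first endpoint of each is the second endpoint of the
     other, so [i = ordS (ordS i)], which fails modulo 4. *)
  have [/tI//|/tI iSj] := chord1_eqmx E.
  have E' : (chord (t j) 1 (t (ordS j)) 1 == chord (t i) 1 (t (ordS i)) 1)%MS.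
    by rewrite andbC.
  have [/tI//|/tI jSi] := chord1_eqmx E'.
  by move: iSj; rewrite jSi; case: (i) => [[|[|[|[|//]]]] ?] /(congr1 val).
Qed.

End CircleGeometry.

Lemma focal_quadrE (K : fieldType) (x1 y1 x2 y2 L x y : K) :
  let s1 := (x - x1) ^+ 2 + (y - y1) ^+ 2 in
  let s2 := (x - x2) ^+ 2 + (y - y2) ^+ 2 in
  on_conic (focal_conic x1 y1 x2 y2 L) (row3 x y 1) <->
  L ^+ 4 - 2 * L ^+ 2 * (s1 + s2) + (s1 - s2) ^+ 2 = 0.
Proof.
move=> s1 s2; rewrite on_conic_sym3 /quadr /s1 /s2.
by rewrite [X in X = 0 <-> _](_ : _ = L ^+ 4 - 2 * L ^+ 2 * (s1 + s2) +
  (s1 - s2) ^+ 2) // /s1 /s2; ring.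
Qed.

(** * Uniqueness of the equation of a conic with enough symmetric points *)

Section UniqueEquation.
Variable K : numFieldType.
Variables cx cy dx dy X Y r : K.
Hypotheses (d0 : dx ^+ 2 + dy ^+ 2 != 0) (X0 : X != 0) (Y0 : Y != 0).
Hypothesis r0 : r != 0.

(** Coordinates [(u, v)] refer to the orthogonal frame centred at [(cx, cy)] with first axis
    [(dx, dy)], measured in units of the length of that axis vector. *)
Let pt u v := row3 (cx + u * dx - v * dy) (cy + u * dy + v * dx) 1.

(* In the frame of the axes, the symmetries kill the mixed and linear terms. *)
Lemma seven_point_conic0 (Q : 'M[K]_3) : Q^T = Q ->
  (forall s t, s ^+ 2 = 1 -> t ^+ 2 = 1 -> on_conic Q (pt (s * X) (t * Y))) ->
  (forall s, s ^+ 2 = 1 -> on_conic Q (pt (s * r) 0)) ->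
  on_conic Q (pt 0 0) -> Q = 0.
Proof.
move=> /sym3_eta->.
move: (Q 0 0) (Q 1 1) (Q 2 2) (Q 0 1) (Q 0 2) (Q 1 2) => a b c d e f.
pose q u v := quadr a b c d e f (cx + u * dx - v * dy) (cy + u * dy + v * dx) 1.
move=> HXY Hr /on_conic_sym3 q00.
have s1 : 1 ^+ 2 = 1 :> K by rewrite expr1n.
have sN1 : (-1) ^+ 2 = 1 :> K by rewrite sqrrN expr1n.
have qXY s t : s ^+ 2 = 1 -> t ^+ 2 = 1 -> q (s * X) (t * Y) = 0.
  by move=> ? ?; apply/on_conic_sym3/HXY.
have qr s : s ^+ 2 = 1 -> q (s * r) 0 = 0.
  by move=> ?; apply/on_conic_sym3/Hr.
have {}q00 : q 0 0 = 0 by [].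
(* [A], [B], [D], [E], [F] are the coefficients of the conic in the frame; its constant term is
   [q 0 0 = 0]. *)
pose A := a * dx ^+ 2 + b * dy ^+ 2 + 2 * d * dx * dy.
pose B := a * dy ^+ 2 + b * dx ^+ 2 - 2 * d * dx * dy.
pose D := (b - a) * dx * dy + d * (dx ^+ 2 - dy ^+ 2).
pose E := a * cx * dx + b * cy * dy + d * (cx * dy + cy * dx) + e * dx + f * dy.
pose F := b * cy * dx - a * cx * dy + d * (cx * dx - cy * dy) - e * dy + f * dx.
have qE u v : q u v =
    A * u ^+ 2 + B * v ^+ 2 + 2 * (D * u * v + E * u + F * v).
  by rewrite -[RHS]addr0 -q00 /q /quadr /A /B /D /E /F; ring.
have z8 : 8 != 0 :> K by rewrite pnatr_eq0.
have D0 : D = 0.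
  have : 8 * (X * Y) * D = q (1 * X) (1 * Y) - q (1 * X) (-1 * Y)
    - q (-1 * X) (1 * Y) + q (-1 * X) (-1 * Y) by rewrite !qE; ring.
  rewrite !qXY // !(subr0, addr0) => /eqP.
  by rewrite !mulf_eq0 (negPf X0) (negPf Y0) (negPf z8) => /eqP.
have F0 : F = 0.
  have : 8 * Y * F = q (1 * X) (1 * Y) - q (1 * X) (-1 * Y)
    + q (-1 * X) (1 * Y) - q (-1 * X) (-1 * Y) by rewrite !qE; ring.
  rewrite !qXY // !(subr0, addr0) => /eqP.
  by rewrite !mulf_eq0 (negPf Y0) (negPf z8) => /eqP.
have E0 : E = 0.
  have : 8 * r * E = 2 * q (1 * r) 0 - 2 * q (-1 * r) 0 by rewrite !qE; ring.
  rewrite !qr // !(mulr0, subr0) => /eqP.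
  by rewrite !mulf_eq0 (negPf r0) (negPf z8) => /eqP.
have A0 : A = 0.
  have : A * r ^+ 2 = q (1 * r) 0 - 2 * E * r by rewrite !qE; ring.
  rewrite qr // E0 !(mulr0, mul0r, subr0) => /eqP.
  by rewrite mulf_eq0 expf_eq0 (negPf r0) orbF => /eqP.
have B0 : B = 0.
  have : B * Y ^+ 2 = q (1 * X) (1 * Y) - A * X ^+ 2
    - 2 * (D * X * Y + E * X + F * Y) by rewrite !qE; ring.
  rewrite qXY // A0 D0 E0 F0 !(mulr0, mul0r, subr0, addr0) => /eqP.
  by rewrite mulf_eq0 expf_eq0 (negPf Y0) orbF => /eqP.
have d20 : (dx ^+ 2 + dy ^+ 2) ^+ 2 != 0 by rewrite expf_neq0.
(* Rotating back recovers the original coefficients up to powers of [dx^2 + dy^2]. *)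
have a0 : a = 0.
  apply: (mulIf d20); rewrite mul0r.
  transitivity (A * dx ^+ 2 + B * dy ^+ 2 - 2 * D * dx * dy).
    by rewrite /A /B /D; ring.
  by rewrite A0 B0 D0; ring.
have b0 : b = 0.
  apply: (mulIf d20); rewrite mul0r.
  transitivity (A * dy ^+ 2 + B * dx ^+ 2 + 2 * D * dx * dy).
    by rewrite /A /B /D; ring.
  by rewrite A0 B0 D0; ring.
have d'0 : d = 0.
  apply: (mulIf d20); rewrite mul0r.
  transitivity ((A - B) * dx * dy + D * (dx ^+ 2 - dy ^+ 2)).
    by rewrite /A /B /D; ring.
  by rewrite A0 B0 D0; ring.
have e0 : e = 0.
  apply: (mulIf d0); rewrite mul0r.
  transitivity (E * dx - F * dy).
    by rewrite /E /F a0 b0 d'0; ring.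
  by rewrite E0 F0; ring.
have f0 : f = 0.
  apply: (mulIf d0); rewrite mul0r.
  transitivity (E * dy + F * dx).
    by rewrite /E /F a0 b0 d'0; ring.
  by rewrite E0 F0; ring.
have c0 : c = 0.
  by rewrite -q00 /q /quadr a0 b0 d'0 e0 f0; ring.
rewrite a0 b0 c0 d'0 e0 f0.
by apply/matrixP; apply: ord3P; apply: ord3P; rewrite !mxE.
Qed.

(** Subtracting from [Q] the multiple of [Q0] with the same value at the centre leaves a conic
    through all seven points, hence zero. So a real point set determines its complexified conic. *)
Lemma conic_unique (Q0 Q : 'M[K]_3) : Q0^T = Q0 -> Q^T = Q -> Q != 0 ->
  (forall s t, s ^+ 2 = 1 -> t ^+ 2 = 1 -> on_conic Q0 (pt (s * X) (t * Y))) ->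
  (forall s, s ^+ 2 = 1 -> on_conic Q0 (pt (s * r) 0)) ->
  ~ on_conic Q0 (pt 0 0) ->
  (forall x y, on_conic Q0 (row3 x y 1) -> on_conic Q (row3 x y 1)) ->
  exists2 k, k != 0 & Q = k *: Q0.
Proof.
move=> Q0s Qs Qn0 HXY Hr nQ0 sub.
pose val (M : 'M[K]_3) (p : 'rV[K]_3) := (p *m M *m p^T) 0 0.
have valP M p : on_conic M p <-> val M p = 0.
  rewrite /on_conic /val; split=> [->|v0]; first by rewrite mxE.
  by apply/matrixP => i j; rewrite !ord1 v0 mxE.
have val0 : val Q0 (pt 0 0) != 0 by apply/eqP => /valP.
pose k := val Q (pt 0 0) / val Q0 (pt 0 0).
have linv p : val (Q - k *: Q0) p = val Q p - k * val Q0 p.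
  by rewrite /val mulmxBr mulmxBl -scalemxAr -scalemxAl !mxE.
have both p : on_conic Q p -> on_conic Q0 p -> on_conic (Q - k *: Q0) p.
  by move=> /valP e1 /valP e2; apply/valP; rewrite linv e1 e2 mulr0 subr0.
have /eqP : Q - k *: Q0 = 0.
  apply: seven_point_conic0.
  - by rewrite linearB linearZ /= Q0s Qs.
  - by move=> s t s2 t2; apply: both; [apply: sub|]; apply: HXY.
  - by move=> s s2; apply: both; [apply: sub|]; apply: Hr.
  - by apply/valP; rewrite linv /k divfK // subrr.
rewrite subr_eq0 => /eqP QE; exists k => //.
by apply: contra_neq Qn0 => k0; rewrite QE k0 scale0r.
Qed.

End UniqueEquation.

(** * The unit circle and its equations *)

Section RealPlane.
Variable R : realType.
Implicit Types (x y L : R) (z : R[i]) (D : set R[i]).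

Lemma normc_sqr z : normc z ^+ 2 = complex.Re z ^+ 2 + complex.Im z ^+ 2.
Proof. by case: z => x y /=; rewrite sqr_sqrtr // addr_ge0 // sqr_ge0. Qed.

Lemma normc_ge0 z : 0 <= normc z.
Proof. by case: z => x y; exact: sqrtr_ge0. Qed.

Lemma unit_circle_equation (Q : 'M[R]_3) :
  has_equation (@unit_circle R) Q ->
  exists2 k, k != 0 & Q = k *: sym3 1 1 (-1) 0 0 0.
Proof.
case=> Qs Qd QE.
have inU x y : on_conic (sym3 1 1 (-1) 0 0 0) (row3 x y 1) <->
    x ^+ 2 + y ^+ 2 = 1.
  rewrite on_conic_sym3 /quadr.
  rewrite [X in X = 0](_ : _ = x ^+ 2 + y ^+ 2 - 1); last by ring.
  by split=> [/eqP|->]; rewrite ?subrr // subr_eq0 => /eqP.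
(* The sample points on the circle are [(3/5, 4/5)] and [(1, 0)] with all changes of sign. *)
apply: (@conic_unique R 0 0 1 0 (3 / 5) (4 / 5) 1) => //.
- by rewrite expr1n expr0n addr0 oner_eq0.
- by rewrite mulf_neq0 ?invr_eq0 ?pnatr_eq0.
- by rewrite mulf_neq0 ?invr_eq0 ?pnatr_eq0.
- exact: oner_neq0.
- exact: sym3_tr.
- by apply: contra_neq Qd => ->; rewrite det0.
- move=> s t s2 t2; apply/inU.
  transitivity (s ^+ 2 * (9 / 25) + t ^+ 2 * (16 / 25)); first by field.
  by rewrite s2 t2; field.
- move=> s s2; apply/inU; transitivity (s ^+ 2); [by ring|by []].
- move/inU => /eqP; rewrite !(mul0r, mulr0, addr0, subr0) expr0n addr0 eq_sym.
  by rewrite oner_eq0.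
- move=> x y /inU xy.
  have : unit_circle (x +i* y)%C.
    by rewrite /unit_circle /= xy sqrtr1.
  by rewrite QE.
Qed.

Lemma unit_circle_has_equation :
  has_equation (@unit_circle R) (sym3 1 1 (-1) 0 0 0).
Proof.
split; first exact: sym3_tr.
  have /(congr1 determinant) :
      sym3 1 1 (-1) 0 0 0 *m sym3 1 1 (-1) 0 0 0 = 1%:M :> 'M[R]_3.
    apply/matrixP; apply: ord3P; apply: ord3P;
      by rewrite !mxE sum_ord3 !mxE /=; ring.
  rewrite det_mulmx det1 => /eqP; apply: contraTneq => ->.
  by rewrite mul0r eq_sym oner_eq0.
apply/seteqP; split=> -[x y] h.
  have e : 1 = x ^+ 2 + y ^+ 2.
    by rewrite -(normc_sqr (x +i* y)%C) (h : normc _ = 1) expr1n.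
  have : on_conic (sym3 1 1 (-1) 0 0 0) (row3 x y 1); last by [].
  apply/on_conic_sym3; transitivity (x ^+ 2 + y ^+ 2 - 1).
    by rewrite /quadr; ring.
  by rewrite -e subrr.
have {h} /on_conic_sym3 h : on_conic (sym3 1 1 (-1) 0 0 0) (row3 x y 1) by [].
rewrite /unit_circle /=.
have -> : x ^+ 2 + y ^+ 2 = 1.
  by apply/eqP; rewrite -subr_eq0 -h; apply/eqP; rewrite /quadr; ring.
exact: sqrtr1.
Qed.

Lemma circle_complexify (Q : 'M[R]_3) k (v : 'rV[R[i]]_3) : k != 0 ->
  Q = k *: sym3 1 1 (-1) 0 0 0 ->
  on_conic (complexify Q) v <-> on_conic (sym3 1 1 (-1) 0 0 0) v.
Proof.
move=> k0 ->.
have -> : complexify (k *: sym3 1 1 (-1) 0 0 0) =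
    k%:C%C *: sym3 1 1 (-1) 0 0 0.
  apply/matrixP; apply: ord3P; apply: ord3P;
    by rewrite !mxE /= ?rmorphM ?rmorphN ?rmorph1 ?rmorph0.
have kC : k%:C%C != 0 :> R[i] by rewrite fmorph_eq0.
rewrite /on_conic -scalemxAr -scalemxAl; split=> [/eqP|->]; last exact: scaler0.
by rewrite scaler_eq0 (negPf kC) => /eqP.
Qed.

End RealPlane.

(** * Ellipses and hyperbolas as loci of one focal equation *)

Section FocalConic.
Variable R : realType.
Variables x1 y1 x2 y2 : R.
Implicit Types (L : R) (D : set R[i]).
Let f1 : R[i] := (x1 +i* y1)%C.
Let f2 : R[i] := (x2 +i* y2)%C.
Hypothesis f12 : f1 != f2.
Let d2 := (x1 - x2) ^+ 2 + (y1 - y2) ^+ 2.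
Let d := normc (f1 - f2).

Let dE : d ^+ 2 = d2.
Proof. by rewrite /d normc_sqr. Qed.

Let d_gt0 : 0 < d.
Proof.
rewrite lt_def normc_ge0 andbT; apply: contra_neq f12 => /eq0_normc/eqP.
by rewrite subr_eq0 => /eqP.
Qed.

Definition focal_locus L : set R[i] :=
  [set z | on_conic (focal_conic x1 y1 x2 y2 L) (affine_point z)].

(** The quartic in [L] has as roots, with both signs, the sum and the difference of the distances to
    the foci. *)
Lemma focal_locusE L (z : R[i]) : focal_locus L z <->
  (L - (normc (z - f1) + normc (z - f2))) *
  (L + (normc (z - f1) + normc (z - f2))) *
  ((L - (normc (z - f1) - normc (z - f2))) *
   (L + (normc (z - f1) - normc (z - f2)))) = 0.
Proof.
case: z => x y; have e1 := normc_sqr ((x +i* y)%C - f1).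
have e2 := normc_sqr ((x +i* y)%C - f2).
set n1 := normc _ in e1 *; set n2 := normc _ in e2 *.
have -> : focal_locus L (x +i* y)%C <->
  on_conic (focal_conic x1 y1 x2 y2 L) (row3 x y 1) by [].
rewrite focal_quadrE.
have {}e1 : (x - x1) ^+ 2 + (y - y1) ^+ 2 = n1 ^+ 2 by rewrite e1.
have {}e2 : (x - x2) ^+ 2 + (y - y2) ^+ 2 = n2 ^+ 2 by rewrite e2.
rewrite e1 e2 [X in X = 0 <-> _](_ : _ = (L - (n1 + n2)) * (L + (n1 + n2)) *
  ((L - (n1 - n2)) * (L + (n1 - n2)))) //.
by ring.
Qed.

Let triangle (z : R[i]) : d <= normc (z - f1) + normc (z - f2).
Proof.
rewrite /d (_ : f1 - f2 = (z - f2) - (z - f1)); last by ring.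
by rewrite (le_trans (le_normcD _ _)) // normcN addrC.
Qed.

Let triangle_diff (z : R[i]) : `|normc (z - f1) - normc (z - f2)| <= d.
Proof.
have le12 : normc (z - f1) <= normc (z - f2) + d.
  rewrite (_ : z - f1 = (z - f2) - (f1 - f2)); last by ring.
  by rewrite (le_trans (le_normcD _ _)) // normcN.
have le21 : normc (z - f2) <= normc (z - f1) + d.
  rewrite (_ : z - f2 = (z - f1) + (f1 - f2)); last by ring.
  by rewrite (le_trans (le_normcD _ _)).
by rewrite ler_norml; apply/andP; split; lra.
Qed.

(** For [d < L] the triangle inequalities leave only the factor of [focal_locusE] in which [L]
    equals the sum of the distances. *)
Lemma is_ellipseP L D : is_ellipse f1 f2 L D <-> d < L /\ D = focal_locus L.
Proof.
suff E : d < L -> focal_locus L =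
    [set z | normc (z - f1) + normc (z - f2) = L].
  by split=> -[dL ->]; split=> //; rewrite E.
move=> dL; apply/seteqP; split=> z.
  move/focal_locusE/eqP; have := triangle z; have := triangle_diff z.
  have := d_gt0; rewrite ler_norml => d0 /andP[t1 t2] t3.
  by rewrite !mulf_eq0 => /orP[/orP[]|/orP[]] /eqP h /=; lra.
by move=> /= Lz; apply/focal_locusE; rewrite Lz subrr !mul0r.
Qed.

(** For [0 < L < d] the two factors with the sum cannot vanish, as the sum is at least [d]; the
    other two give the branches. *)
Lemma is_hyperbolaP L D :
  is_hyperbola f1 f2 L D <-> 0 < L < d /\ D = focal_locus L.
Proof.
suff E : 0 < L < d -> focal_locus L =
    [set z | `|normc (z - f1) - normc (z - f2)| = L].
  by split=> -[dL ->]; split=> //; rewrite E.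
move=> /andP[L0 Ld]; apply/seteqP; split=> z.
  move/focal_locusE/eqP; have := triangle z => t /=.
  rewrite !mulf_eq0 => /orP[/orP[]|/orP[]] /eqP h; [lra|lra| |].
    by rewrite (_ : _ - _ = L) ?gtr0_norm //; lra.
  by rewrite (_ : _ - _ = - L) ?normrN ?gtr0_norm //; lra.
move=> /= Lz; apply/focal_locusE; apply/eqP; rewrite mulf_eq0; apply/orP; right.
by rewrite -subr_sqr -Lz real_normK ?num_real // subrr.
Qed.

Lemma is_central_conicP L D : is_central_conic f1 f2 L D <->
  [/\ 0 < L, L ^+ 2 - d2 != 0 & D = focal_locus L].
Proof.
rewrite /is_central_conic is_ellipseP is_hyperbolaP -dE subr_eq0.
have d0 := d_gt0; split=> [[[dL ->]|[/andP[L0 dL] ->]]|[L0 Ld ->]].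
- by split=> //; [lra|rewrite eqrXn2 // ?gt_eqF //; lra].
- by split=> //; rewrite eqrXn2 // ?lt_eqF //; lra.
- have : L != d by apply: contra_neq Ld => ->.
  rewrite neq_lt => /orP[Ld'|dL]; first by right; rewrite L0.
  by left.
Qed.

Lemma focal_locus_has_equation L : L != 0 -> L ^+ 2 - d2 != 0 ->
  has_equation (focal_locus L) (focal_conic x1 y1 x2 y2 L).
Proof.
move=> L0 k0; split=> //; first exact: sym3_tr.
have /(congr1 determinant) := focal_conic_dual x1 y1 x2 y2 L.
have nz : 4 * L ^+ 2 * (L ^+ 2 - (x1 - x2) ^+ 2 - (y1 - y2) ^+ 2) != 0.
  by rewrite mulf_neq0 ?mulf_neq0 ?pnatr_eq0 ?expf_neq0 // -addrA -opprD.
rewrite det_mulmx det_scalar => E; apply/eqP => D0.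
by have /eqP := expf_neq0 3 nz; apply; rewrite -E D0 mul0r.
Qed.

(** Both kinds of conic have enough real points for [conic_unique]: the two vertices on the focal
    axis and four points symmetric about both axes. *)
Lemma focal_locus_equation L (Q : 'M[R]_3) : 0 < L -> L ^+ 2 - d2 != 0 ->
  has_equation (focal_locus L) Q ->
  exists2 k, k != 0 & Q = k *: focal_conic x1 y1 x2 y2 L.
Proof.
move=> L0 k0 [Qs Qd QE].
pose cx := (x1 + x2) / 2; pose cy := (y1 + y2) / 2.
pose dx := x1 - x2; pose dy := y1 - y2; pose K := L ^+ 2 - d2.
have d20 : d2 != 0 by rewrite -dE expf_neq0 // gt_eqF // d_gt0.
have qE u v : on_conic (focal_conic x1 y1 x2 y2 L)
    (row3 (cx + u * dx - v * dy) (cy + u * dy + v * dx) 1) <->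
    K * (L ^+ 2 - 4 * d2 * u ^+ 2) - 4 * L ^+ 2 * d2 * v ^+ 2 = 0.
  rewrite focal_quadrE; set A := (X in X = 0 <-> _).
  set B := (X in _ <-> X = 0).
  suff -> : A = B by [].
  by rewrite /A /B /K /d2 /cx /cy /dx /dy; field.
have [X [Y [X0 Y0 XY]]] : exists X Y, [/\ X != 0, Y != 0 &
    K * (L ^+ 2 - 4 * d2 * X ^+ 2) = 4 * L ^+ 2 * d2 * Y ^+ 2].
  have L_neq0 : L != 0 by rewrite gt_eqF.
  have d2_gt0 : 0 < d2 by rewrite -dE exprn_gt0 // d_gt0.
  have d_neq0 : d != 0 by rewrite gt_eqF // d_gt0.
  (* For an ellipse ([K > 0]) [1 - (3/5)^2 = (4/5)^2], and for a hyperbola [(5/3)^2 - 1 = (4/3)^2],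
     so the only root to extract is that of [K] or [- K]. *)
  have [Kpos|Kneg|/eqP] := ltgtP 0 K; last by rewrite eq_sym (negPf k0).
  - exists (3 / 5 * L / (2 * d)), (2 / 5 * Num.sqrt K / d).
    have sK : Num.sqrt K != 0 by rewrite gt_eqF // sqrtr_gt0.
    have sK2 : K = Num.sqrt K ^+ 2 by rewrite sqr_sqrtr // ltW.
    split; [by do ?[apply: mulf_neq0|apply: invr_neq0]; rewrite ?pnatr_eq0
           |by do ?[apply: mulf_neq0|apply: invr_neq0]; rewrite ?pnatr_eq0|].
    by rewrite {1}sK2 -dE; field.
  - exists (5 / 3 * L / (2 * d)), (2 / 3 * Num.sqrt (- K) / d).
    have sK : Num.sqrt (- K) != 0 by rewrite gt_eqF // sqrtr_gt0 oppr_gt0.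
    have sK2 : K = - Num.sqrt (- K) ^+ 2.
      by rewrite sqr_sqrtr ?opprK // oppr_ge0 ltW.
    split; [by do ?[apply: mulf_neq0|apply: invr_neq0]; rewrite ?pnatr_eq0
           |by do ?[apply: mulf_neq0|apply: invr_neq0]; rewrite ?pnatr_eq0|].
    by rewrite {1}sK2 -dE; field.
apply: (@conic_unique R cx cy dx dy X Y (L / (2 * d))) => //.
- by rewrite mulf_neq0 ?invr_eq0 ?mulf_neq0 ?pnatr_eq0 ?gt_eqF ?d_gt0.
- exact: sym3_tr.
- by apply: contra_neq Qd => ->; rewrite det0.
- move=> s t s2 t2; apply/qE.
  by rewrite !exprMn s2 t2 !mul1r XY subrr.
- move=> s s2; apply/qE; rewrite -dE !exprMn s2.
  by field; rewrite gt_eqF // d_gt0.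
- move/qE; rewrite expr0n /= !mulr0 !subr0 => /eqP.
  by rewrite mulf_eq0 (negPf k0) expf_eq0 gt_eqF.
- move=> x y xy.
  have : focal_locus L (x +i* y)%C by [].
  by rewrite QE.
Qed.

End FocalConic.

(** * The criterion for a 4-gon in terms of the axis length *)

Lemma complexify_focal_conic (R : realType) (x1 y1 x2 y2 L k : R) :
  complexify (k *: focal_conic x1 y1 x2 y2 L) =
  k%:C%C *: focal_conic x1%:C%C y1%:C%C x2%:C%C y2%:C%C L%:C%C.
Proof.
apply/matrixP; apply: ord3P; apply: ord3P; rewrite !mxE /=; ring.
Qed.

(** The three combinations [f1 g1], [f2 g2] and [f1 g2 + g1 f2] are real once each [g] is the
    conjugate of its [f]. *)
Lemma corr_detE (K : fieldType) (f1 g1 f2 g2 k : K) :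
  corr_det f1 g1 f2 g2 k =
  (f1 * g2 + g1 * f2 + 2 - k) * (f1 * g1 * (f2 * g2) - 1)
  - (f1 * g1 + f2 * g2) * (f1 * g2 + g1 * f2) - 4 * (f1 * g1 * (f2 * g2))
  + 2 * (f1 * g1 + f2 * g2 + (f1 * g2 + g1 * f2)).
Proof. by rewrite /corr_det; ring. Qed.

Section Criterion.
Variable R : realType.
Variables x1 y1 x2 y2 : R.
Let f1 : R[i] := (x1 +i* y1)%C.
Let f2 : R[i] := (x2 +i* y2)%C.
Let n1 := x1 ^+ 2 + y1 ^+ 2.
Let n2 := x2 ^+ 2 + y2 ^+ 2.
(** Twice the real part of [conjc f1 * f2]; thus [n1 * n2 + 1 - h] is the squared modulus of
    [1 - conjc f1 * f2], and [d2 = n1 + n2 - h]. *)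
Let h := 2 * (x1 * x2 + y1 * y2).
Let d2 := (x1 - x2) ^+ 2 + (y1 - y2) ^+ 2.

Let xyE (x y : R) : (x +i* y)%C = x%:C%C + 'i * y%:C%C.
Proof. by rewrite -complexiE [LHS]complexE. Qed.

Let conjE (x y : R) : conjc (x +i* y)%C = x%:C%C - 'i * y%:C%C.
Proof. by rewrite /= xyE rmorphN mulrN. Qed.

Lemma focal_corr_det L :
  corr_det (x1%:C%C + 'i * y1%:C%C) (x1%:C%C - 'i * y1%:C%C)
           (x2%:C%C + 'i * y2%:C%C) (x2%:C%C - 'i * y2%:C%C)
           (L%:C%C ^+ 2 - (x1%:C%C - x2%:C%C) ^+ 2 - (y1%:C%C - y2%:C%C) ^+ 2)
  = (L ^+ 2 * (1 - n1 * n2) - (2 - n1 - n2) * (n1 * n2 + 1 - h))%:C%C.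
Proof.
have nE x y : (x%:C%C + 'i * y%:C%C) * (x%:C%C - 'i * y%:C%C) =
    (x ^+ 2 + y ^+ 2)%:C%C :> R[i].
  transitivity (x%:C%C ^+ 2 - 'i ^+ 2 * y%:C%C ^+ 2 : R[i]); first by ring.
  by rewrite sqrCi; ring.
have hE : (x1%:C%C + 'i * y1%:C%C) * (x2%:C%C - 'i * y2%:C%C) +
    (x1%:C%C - 'i * y1%:C%C) * (x2%:C%C + 'i * y2%:C%C) = h%:C%C :> R[i].
  transitivity (2 * (x1%:C%C * x2%:C%C - 'i ^+ 2 * (y1%:C%C * y2%:C%C)) : R[i]).
    by ring.
  by rewrite sqrCi /h; ring.
rewrite corr_detE hE !nE /n1 /n2 /h; ring.
Qed.

Hypothesis f12 : f1 != f2.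
Hypotheses (n1_neq1 : n1 != 1) (n2_neq1 : n2 != 1).
Hypothesis N_gt0 : 0 < n1 * n2 + 1 - h.

(** All equations of either curve are proportional, so tangency can be tested on [focal_conic] and
    the determinant decides. The quantity [1 - n1 * n2] is the [y0] of [corr_cycle_exists]. *)
Lemma focal_poncelet L : 0 < L -> L ^+ 2 - d2 != 0 ->
  poncelet_pair 4 (@unit_circle R) (focal_locus x1 y1 x2 y2 L) <->
  1 - n1 * n2 != 0 /\
  L ^+ 2 * (1 - n1 * n2) = (2 - n1 - n2) * (n1 * n2 + 1 - h).
Proof.
move=> L0 k0.
pose G : 'M[R[i]]_3 := dual_conic x1%:C%C y1%:C%C x2%:C%C y2%:C%C
  (L%:C%C ^+ 2 - (x1%:C%C - x2%:C%C) ^+ 2 - (y1%:C%C - y2%:C%C) ^+ 2).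
have tangP k (l : 'rV[R[i]]_3) : k != 0 ->
    is_tangent (complexify (k *: focal_conic x1 y1 x2 y2 L)) l <->
    l != 0 /\ on_conic G l.
  move=> kn0; rewrite complexify_focal_conic.
  apply: (@is_tangent_dual _ _ _ (k * (4 * L ^+ 2 * (L ^+ 2 - d2)))%:C%C).
  - by rewrite linearZ /= sym3_tr.
  - exact: sym3_tr.
  - by rewrite fmorph_eq0 !mulf_neq0 ?expf_neq0 ?pnatr_eq0 ?(gt_eqF L0).
  - rewrite -scalemxAl focal_conic_dual scale_scalar_mx.
    by congr (_%:M); rewrite /d2; ring.
have detP : corr_det (x1%:C%C + 'i * y1%:C%C) (x1%:C%C - 'i * y1%:C%C)
           (x2%:C%C + 'i * y2%:C%C) (x2%:C%C - 'i * y2%:C%C)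
           (L%:C%C ^+ 2 - (x1%:C%C - x2%:C%C) ^+ 2 - (y1%:C%C - y2%:C%C) ^+ 2)
    = 0 <-> L ^+ 2 * (1 - n1 * n2) = (2 - n1 - n2) * (n1 * n2 + 1 - h).
  rewrite focal_corr_det; split=> [/eqP|->]; last by rewrite subrr.
  by rewrite fmorph_eq0 subr_eq0 => /eqP.
split=> [[QC [QD [HC HD [v [l [poly vC lD]]]]]]|[nn /detP D0]].
  have [k kn0 QCE] := unit_circle_equation HC.
  have [k' k'n0 QDE] := focal_locus_equation f12 L0 k0 HD.
  have /detP E : corr_det (x1%:C%C + 'i * y1%:C%C) (x1%:C%C - 'i * y1%:C%C)
           (x2%:C%C + 'i * y2%:C%C) (x2%:C%C - 'i * y2%:C%C)
           (L%:C%C ^+ 2 - (x1%:C%C - x2%:C%C) ^+ 2 - (y1%:C%C - y2%:C%C) ^+ 2)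
           = 0.
    apply: (polygon_corr_det poly).
      by move=> i; apply/(circle_complexify _ kn0 QCE).
    by move=> i; have := lD i; rewrite QDE => /(tangP _ _ k'n0)[].
  split=> //; rewrite subr_eq0 eq_sym; apply/eqP => nn.
  (* If [n1 n2 = 1], the equation leaves [n1 + n2 = 2], hence [n1 = n2 = 1]. *)
  move/eqP: E; rewrite nn subrr mulr0 eq_sym mulf_eq0.
  rewrite -[X in X + 1 - h]nn [X in _ || X]gt_eqF // orbF => /eqP m2.
  have : (n1 - 1) ^+ 2 = 0.
    have n2E : n2 = 2 - n1 by lra.
    transitivity (1 - n1 * n2); first by rewrite n2E; ring.
    by rewrite nn subrr.
  by move/eqP; rewrite expf_eq0 subr_eq0 (negPf n1_neq1).
exists (sym3 1 1 (-1) 0 0 0), (focal_conic x1 y1 x2 y2 L); split.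
- exact: unit_circle_has_equation.
- by apply: focal_locus_has_equation; rewrite ?(gt_eqF L0).
have nC x y : (x +i* y)%C * conjc (x +i* y)%C = (x ^+ 2 + y ^+ 2)%:C%C :> R[i].
  by apply/eqP; rewrite eq_complex /=; apply/andP; split; apply/eqP; ring.
have norm1 : f1 * conjc f1 != 1.
  by rewrite nC -[1]/(1%:C%C) (inj_eq (@complexI R)).
have norm2 : f2 * conjc f2 != 1.
  by rewrite nC -[1]/(1%:C%C) (inj_eq (@complexI R)).
have mixed : f1 * conjc f2 != 1.
  apply: contraTneq N_gt0 => E; rewrite -leNgt.
  have -> : n1 * n2 + 1 - h = normc (f1 * conjc f2 - 1) ^+ 2.
    by rewrite normc_sqr /= /n1 /n2 /h; ring.
  by rewrite E subrr normc0 expr0n.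
have mixed' : f2 * conjc f1 != 1.
  apply: contra_neq mixed => E.
  have -> : f1 * conjc f2 = conjc (f2 * conjc f1).
    by apply/eqP; rewrite eq_complex /=; apply/andP; split; apply/eqP; ring.
  by rewrite E conjc1.
have nn' : 1 - f1 * f2 * (conjc f1 * conjc f2) != 0.
  have -> : f1 * f2 * (conjc f1 * conjc f2) = (n1 * n2)%:C%C.
    by rewrite mulrACA [f1 * _]nC [f2 * _]nC rmorphM.
  by rewrite -(rmorph1 (real_complex R)) -rmorphB fmorph_eq0.
rewrite -!conjE -!xyE -/f1 -/f2 in D0.
have [t1 [t2 [t3 [t4 [tu [F12 F23 F34 F41]]]]]] :=
  corr_cycle_exists f12 norm1 mixed mixed' norm2 nn' D0.
pose t (i : 'I_4) := nth 0 [:: t1; t2; t3; t4] i.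
have tI : injective t.
  by move=> i j /eqP; rewrite nth_uniq // => /eqP/val_inj.
have Ft i : corr (x1%:C%C + 'i * y1%:C%C) (x1%:C%C - 'i * y1%:C%C)
      (x2%:C%C + 'i * y2%:C%C) (x2%:C%C - 'i * y2%:C%C)
      (L%:C%C ^+ 2 - (x1%:C%C - x2%:C%C) ^+ 2 - (y1%:C%C - y2%:C%C) ^+ 2)
      (t i) 1 (t (ordS i)) 1 = 0.
  by rewrite -!conjE -!xyE; case: i => [[|[|[|[|//]]]] ?].
have [v [l [poly vC l0 lG]]] := corr_cycle_polygon tI Ft.
exists v, l; split; first exact: poly.
- move=> i; apply/(circle_complexify (k := 1) _ _ _); last exact: vC.
    exact: oner_neq0.
  by rewrite scale1r.
- move=> i; rewrite -[focal_conic _ _ _ _ _]scale1r.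
  apply/(tangP _ _ (oner_neq0 R)); split; [exact: l0|exact: lG].
Qed.

End Criterion.

(** Existence is stated with its exact conditions: the last two make the equation for [L^2] solvable
    with [L > 0], and the nonzero real part keeps [L] different from the focal distance, where the
    conic degenerates. *)
Theorem theorem2p4 (R : realType) (a1 a2 : R[i])
    (a1_neq_a2 : a1 != a2)
    (a1_notin_T : ~ unit_circle a1) (a2_notin_T : ~ unit_circle a2)
    (not_inverse : conjc a1 * a2 != 1) :
  ((exists! D : set R[i], poncelet_conic 4 a1 a2 D) <->
   [/\ complex.Re (1 - conjc a1 * a2) != 0,
       1 - normc a1 ^+ 2 * normc a2 ^+ 2 != 0
     & 0 < (2 - normc a1 ^+ 2 - normc a2 ^+ 2) /
           (1 - normc a1 ^+ 2 * normc a2 ^+ 2)]) /\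
  (forall D : set R[i], poncelet_conic 4 a1 a2 D ->
    [/\ (normc a1 < 1 -> normc a2 < 1 -> exists L, is_ellipse a1 a2 L D),
        (1 < normc a1 -> 1 < normc a2 ->
          (complex.Re (1 - conjc a1 * a2) < 0 ->
             exists L, is_ellipse a1 a2 L D) /\
          (0 < complex.Re (1 - conjc a1 * a2) ->
             exists L, is_hyperbola a1 a2 L D)),
        (normc a1 < 1 -> 1 < normc a2 ->
          (complex.Re (1 - conjc a1 * a2) *
             (1 - normc a1 ^+ 2 * normc a2 ^+ 2) < 0 ->
             exists L, is_ellipse a1 a2 L D) /\
          (0 < complex.Re (1 - conjc a1 * a2) *
             (1 - normc a1 ^+ 2 * normc a2 ^+ 2) ->
             exists L, is_hyperbola a1 a2 L D))
      & forall L, is_central_conic a1 a2 L D ->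
          L = normc (1 - conjc a1 * a2) *
              Num.sqrt ((2 - normc a1 ^+ 2 - normc a2 ^+ 2) /
                        (1 - normc a1 ^+ 2 * normc a2 ^+ 2))]).
Proof.
case: a1 a2 a1_neq_a2 a1_notin_T a2_notin_T not_inverse => [x1 y1] [x2 y2].
set a1 := (x1 +i* y1)%C; set a2 := (x2 +i* y2)%C => a12 a1T a2T inv.
pose n1 := x1 ^+ 2 + y1 ^+ 2; pose n2 := x2 ^+ 2 + y2 ^+ 2.
pose h := 2 * (x1 * x2 + y1 * y2).
pose d2 := (x1 - x2) ^+ 2 + (y1 - y2) ^+ 2.
have n1E : normc a1 ^+ 2 = n1 by rewrite normc_sqr.
have n2E : normc a2 ^+ 2 = n2 by rewrite normc_sqr.
have d2E : normc (a1 - a2) ^+ 2 = d2 by rewrite normc_sqr.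
have n1_neq1 : n1 != 1.
  apply: contra_notN a1T => /eqP n1_1; rewrite /unit_circle /=.
  by rewrite -/n1 n1_1 sqrtr1.
have n2_neq1 : n2 != 1.
  apply: contra_notN a2T => /eqP n2_1; rewrite /unit_circle /=.
  by rewrite -/n2 n2_1 sqrtr1.
have NE : normc (1 - conjc a1 * a2) ^+ 2 = n1 * n2 + 1 - h.
  by rewrite normc_sqr /= /n1 /n2 /h; ring.
have c_gt0 : 0 < normc (1 - conjc a1 * a2).
  rewrite lt_def normc_ge0 andbT; apply: contra_neq inv => /eq0_normc/eqP.
  by rewrite subr_eq0 eq_sym => /eqP.
have N_gt0 : 0 < n1 * n2 + 1 - h by rewrite -NE exprn_gt0.
have ReE : complex.Re (1 - conjc a1 * a2) = 1 - h / 2.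
  by rewrite /= /h; field.
rewrite ReE n1E n2E.
set q := (2 - n1 - n2) / (1 - n1 * n2).
have centralP L D : is_central_conic a1 a2 L D <->
    [/\ 0 < L, L ^+ 2 - d2 != 0 & D = focal_locus x1 y1 x2 y2 L].
  exact: is_central_conicP.
have key L D : is_central_conic a1 a2 L D ->
    poncelet_pair 4 (@unit_circle R) D <->
    1 - n1 * n2 != 0 /\ L ^+ 2 = normc (1 - conjc a1 * a2) ^+ 2 * q.
  move=> /centralP[L0 k0 ->].
  rewrite (focal_poncelet a12 n1_neq1 n2_neq1 N_gt0 L0 k0).
  rewrite NE -/n1 -/n2 -/h /q; split=> -[nn E]; split=> //.
    by apply: (mulIf nn); rewrite E; field.
  by rewrite E; field.
(* The sign of [L^2 - d2] separates ellipses from hyperbolas; this factorization reads it off. *)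
have kE L : 1 - n1 * n2 != 0 -> L ^+ 2 = normc (1 - conjc a1 * a2) ^+ 2 * q ->
    (L ^+ 2 - d2) * (1 - n1 * n2) = 2 * (1 - h / 2) * ((1 - n1) * (1 - n2)).
  move=> nn ->; rewrite NE.
  transitivity ((n1 * n2 + 1 - h) * (2 - n1 - n2) - d2 * (1 - n1 * n2)).
    by rewrite /q; field.
  by rewrite /d2 /h /n1 /n2; field.
have LE L : 0 < L -> L ^+ 2 = normc (1 - conjc a1 * a2) ^+ 2 * q ->
    0 < q /\ L = normc (1 - conjc a1 * a2) * Num.sqrt q.
  move=> L0 L2; have q0 : 0 < q.
    by rewrite -(pmulr_rgt0 _ (exprn_gt0 2 c_gt0)) -L2 exprn_gt0.
  have s0 : 0 <= normc (1 - conjc a1 * a2) * Num.sqrt q.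
    by rewrite (mulr_ge0 (ltW c_gt0)) // sqrtr_ge0.
  split=> //; apply/eqP; rewrite -(eqrXn2 (isT : (0 < 2)%N) (ltW L0) s0).
  by rewrite exprMn (sqr_sqrtr (ltW q0)) L2.
split; [split|].
- move=> [D [[[L cL] /(key _ _ cL)[nn L2]] _]]; have /centralP[L0 k0 _] := cL.
  split=> //; last by have [] := LE L L0 L2.
  apply: contra_neq k0 => re0; apply: (mulIf nn).
  by rewrite (kE _ nn L2) re0 mulr0 !mul0r.
- move=> [re0 nn q0]; pose L := normc (1 - conjc a1 * a2) * Num.sqrt q.
  have L0 : 0 < L by rewrite (mulr_gt0 c_gt0) // sqrtr_gt0.
  have L2 : L ^+ 2 = normc (1 - conjc a1 * a2) ^+ 2 * q.
    by rewrite exprMn (sqr_sqrtr (ltW q0)).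
  have k0 : L ^+ 2 - d2 != 0.
    have : (L ^+ 2 - d2) * (1 - n1 * n2) != 0.
      rewrite (kE _ nn L2) !mulf_neq0 ?pnatr_eq0 // subr_eq0 eq_sym //.
    by rewrite mulf_eq0 negb_or => /andP[].
  have cL : is_central_conic a1 a2 L (focal_locus x1 y1 x2 y2 L).
    exact/centralP.
  exists (focal_locus x1 y1 x2 y2 L); split.
    by split; [exists L|apply/(key _ _ cL)].
  (* Another solution has the same axis length, hence the same locus. *)
  move=> D [[L' cL'] /(key _ _ cL')[_ L'2]]; have /centralP[L'0 _ ->] := cL'.
  by have [_ ->] := LE L' L'0 L'2.
move=> D [[L cL] pD]; have [nn L2] := (key _ _ cL).1 pD.
have /centralP[L0 k0 DE] := cL.
have ellipse : 0 < L ^+ 2 - d2 -> exists L, is_ellipse a1 a2 L D.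
  move=> k_gt0; exists L; apply/(is_ellipseP a12); split=> //.
  by rewrite -(@ltr_pXn2r _ 2) ?nnegrE ?normc_ge0 ?ltW // d2E -subr_gt0.
have hyperbola : L ^+ 2 - d2 < 0 -> exists L, is_hyperbola a1 a2 L D.
  move=> k_lt0; exists L; apply/is_hyperbolaP; split=> //; rewrite L0.
  by rewrite -(@ltr_pXn2r _ 2) ?nnegrE ?normc_ge0 ?ltW // d2E -subr_lt0.
have {}kE := kE L nn L2.
have lt1 (z : R[i]) : (normc z < 1) = (normc z ^+ 2 < 1).
  by rewrite (expr_lt1 (isT : (0 < 2)%N) (normc_ge0 z)).
have gt1 (z : R[i]) : (1 < normc z) = (1 < normc z ^+ 2).
  by rewrite (expr_gt1 (isT : (0 < 2)%N) (normc_ge0 z)).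
have d2_ge0 : 0 <= d2 by rewrite addr_ge0 // sqr_ge0.
have n1_ge0 : 0 <= n1 by rewrite addr_ge0 // sqr_ge0.
have n2_ge0 : 0 <= n2 by rewrite addr_ge0 // sqr_ge0.
have d2h : d2 = n1 + n2 - h by rewrite /d2 /n1 /n2 /h; ring.
rewrite !lt1 !gt1 n1E n2E; split.
(* The real part is positive here: [d2 >= 0] gives [h <= n1 + n2 < 2]. *)
- move=> n1_lt1 n2_lt1; apply: ellipse.
  have nn_gt0 : 0 < 1 - n1 * n2 by nra.
  by rewrite -(pmulr_lgt0 _ nn_gt0) kE !mulr_gt0; lra.
- move=> n1_gt1 n2_gt1; have nn_lt0 : 1 - n1 * n2 < 0 by nra.
  have p_gt0 : 0 < (1 - n1) * (1 - n2) by nra.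
  split=> re; [apply: ellipse|apply: hyperbola].
    by rewrite -(nmulr_llt0 _ nn_lt0) kE pmulr_llt0 // pmulr_rlt0.
  by rewrite -(nmulr_lgt0 _ nn_lt0) kE pmulr_lgt0 // pmulr_rgt0.
- move=> n1_lt1 n2_gt1; have p_lt0 : (1 - n1) * (1 - n2) < 0 by nra.
  (* The sign of [1 - n1 n2] is unknown here, so [kE] is multiplied by it once more. *)
  have nn2 : 0 < (1 - n1 * n2) ^+ 2 by rewrite lt_def sqr_ge0 expf_neq0.
  have kE2 : (L ^+ 2 - d2) * (1 - n1 * n2) ^+ 2 =
      2 * ((1 - h / 2) * (1 - n1 * n2)) * ((1 - n1) * (1 - n2)).
    transitivity ((L ^+ 2 - d2) * (1 - n1 * n2) * (1 - n1 * n2)); first by ring.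
    by rewrite kE; ring.
  split=> re; [apply: ellipse|apply: hyperbola].
    by rewrite -(pmulr_lgt0 _ nn2) kE2 nmulr_lgt0 // pmulr_rlt0.
  by rewrite -(pmulr_llt0 _ nn2) kE2 nmulr_llt0 // pmulr_rgt0.
move=> L' cL'; have [_ L'2] := (key _ _ cL').1 pD.
have /centralP[L'0 _ _] := cL'.
by have [_] := LE L' L'0 L'2.
Qed.
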